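(* Let $0\le t<T$ and let $i_1,i_2\in\{1,\ldots,m\}$ with $i_1\ne i_2$. Let $\{\phi_j\}_{j=0}^{\infty}$ be the complete orthonormal system of Legendre polynomials in $L_2([t,T])$, $$ \phi_j(s)=\sqrt{\frac{2j+1}{T-t}}\,P_j\!\left(\left(s-t-\frac{T-t}{2}\right)\frac{2}{T-t}\right),\qquad j=0,1,2,\ldots, $$ where $P_j(x)$ is the $j$-th Legendre polynomial, and let $\zeta_j^{(i)}=\int_t^T\phi_j(s)\,d{\bf w}_s^{(i)}$. Then the Levy stochastic area $$ A_{T,t}^{(i_1i_2)}=\frac12\left(I_{T,t}^{(i_1i_2)}-I_{T,t}^{(i_2i_1)}\right),\qquad I_{T,t}^{(ij)}=\int\limits_t^T\int\limits_t^s d{\bf w}_{\tau}^{(i)}d{\bf w}_s^{(j)}, $$ has the representation $$ A_{T,t}^{(i_1i_2)}=\frac{T-t}{2}\sum_{j=1}^{\infty}\frac{1}{\sqrt{4j^2-1}}\left(\zeta_{j-1}^{(i_1)}\zeta_{j}^{(i_2)}-\zeta_{j}^{(i_1)}\zeta_{j-1}^{(i_2)}\right), $$ where the series converges in the mean-square sense.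
   Context: $(\Omega,{\rm F},{\sf P})$ is a complete probability space with a nondecreasing right-continuous family of $\sigma$-algebras $\{{\rm F}_s\}$ of ${\rm F}$, and ${\bf w}_s$ is a standard $m$-dimensional Wiener process, adapted to $\{{\rm F}_s\}$, with independent components ${\bf w}_s^{(i)}$, $i=1,\ldots,m$. All stochastic integrals with respect to ${\bf w}^{(i)}$ are Ito integrals. Legendre polynomials have the usual normalization $P_j(1)=1$. Equality of random variables means equality with probability 1, and mean-square convergence means convergence in $L_2(\Omega,{\sf P})$. *)

(* Defs.v *)
From HB Require Import structures.
From mathcomp Require Import all_boot all_order all_algebra.
From mathcomp Require Import all_classical all_reals all_analysis.
Set Implicit Arguments.
Unset Strict Implicit.
Unset Printing Implicit Defensive.
Import Order.TTheory GRing.Theory Num.Theory.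
Import numFieldNormedType.Exports.
Local Open Scope classical_set_scope.
Local Open Scope ring_scope.

(* Time runs over [0, T] for a horizon T. Filtrations, processes and
   integrands are functions on all of R; only their values on [0, T] matter. *)

Record filtration {d : measure_display} {Omega : measurableType d}
    {R : realType} (T : R) (F : R -> set (set Omega)) : Prop := {
  filtration_sigma_algebra :
    forall s : R, 0 <= s <= T -> sigma_algebra [set: Omega] (F s) ;
  filtration_measurable :
    forall s : R, 0 <= s <= T -> F s `<=` measurable ;
  filtration_nondecreasing :
    forall r s : R, 0 <= r -> r <= s -> s <= T -> F r `<=` F s ;
  filtration_right_continuous :
    forall s : R, 0 <= s < T -> \bigcap_(u in `]s, T]) F u = F s }.

(* X is measurable with respect to the sub-sigma-algebra G *)
Definition measurable_for {d : measure_display} {Omega : measurableType d}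
    {R : realType} (G : set (set Omega)) (X : Omega -> R) : Prop :=
  forall B : set R, measurable B -> G (X @^-1` B).

(* the sigma-algebra generated by the random variables X i, i in D *)
Definition sigma_generated {d : measure_display} {Omega : measurableType d}
    {R : realType} {I : Type} (D : set I) (X : I -> Omega -> R) :
    set (set Omega) :=
  <<s \bigcup_(i in D) preimage_set_system [set: Omega] (X i) measurable >>.

Definition independent_pair {d : measure_display} {Omega : measurableType d}
    {R : realType} (P : probability Omega R) (G H : set (set Omega)) : Prop :=
  forall A B : set Omega, G A -> H B -> P (A `&` B) = (P A * P B)%E.

Definition independent_family {d : measure_display} {Omega : measurableType d}
    {R : realType} (P : probability Omega R) {I : finType}
    (G : I -> set (set Omega)) : Prop :=
  forall (D : {set I}) (A : I -> set Omega), (forall i, i \in D -> G i (A i)) ->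
    P (\bigcap_(i in [set` D]) A i) = (\prod_(i in D) P (A i))%E.

(* m-dimensional standard Wiener process on [0, T] relative to F.
   normal_prob takes the standard deviation as its second argument. *)
Record wiener_process {d : measure_display} {Omega : measurableType d}
    {R : realType} (P : probability Omega R) (T : R)
    (F : R -> set (set Omega)) {m : nat} (w : 'I_m -> R -> Omega -> R) :
    Prop := {
  wiener_adapted : forall (i : 'I_m) (s : R), 0 <= s <= T ->
    measurable_for (F s) (w i s) ;
  wiener_init : forall i : 'I_m, {ae P, forall x : Omega, w i 0 x = 0} ;
  wiener_continuous : forall i : 'I_m,
    {ae P, forall x : Omega, {within `[0, T], continuous (fun s => w i s x)}} ;
  wiener_increment_normal : forall (i : 'I_m) (r s : R),
    0 <= r -> r < s -> s <= T -> forall B : set R, measurable B ->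
    P ((fun x => w i s x - w i r x) @^-1` B)
      = normal_prob 0 (Num.sqrt (s - r)) B ;
  wiener_increment_independent : forall r s : R,
    0 <= r -> r < s -> s <= T ->
    independent_pair P (F r)
      (sigma_generated [set: 'I_m] (fun i x => w i s x - w i r x)) ;
  wiener_components_independent :
    independent_family P (fun i : 'I_m => sigma_generated `[0, T] (w i)) }.

Definition mean_square_cvg {d : measure_display} {Omega : measurableType d}
    {R : realType} (P : probability Omega R) (X : nat -> Omega -> R)
    (Y : Omega -> R) : Prop :=
  [/\ forall n, X n \in Lfun P 2%:E,
      Y \in Lfun P 2%:E
    & (fun n => 'E_P[fun x => ((X n x - Y x) ^+ 2)%R])%E @ \oo --> 0%E].

(* The integrands: jointly measurable, adapted and square integrable on
   [a, b] x Omega *)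
Definition ito_integrand {d : measure_display} {Omega : measurableType d}
    {R : realType} (P : probability Omega R) (F : R -> set (set Omega))
    (a b : R) (f : R -> Omega -> R) : Prop :=
  [/\ measurable_fun (`[a, b] `*` [set: Omega])
        (fun z : measurableTypeR R * Omega => f z.1 z.2),
      forall s : R, a <= s <= b -> measurable_for (F s) (f s)
    & (\int[lebesgue_measure]_(s in `[a, b])
         'E_P[fun x => ((f s x) ^+ 2)%R] < +oo)%E].

(* Step processes: the value is step_val k on [step_time k, step_time k.+1[ *)
Record step_process (Omega : Type) (R : realType) := StepProcess {
  step_size : nat ;
  step_time : nat -> R ;
  step_val : nat -> Omega -> R }.

Definition step_adapted {d : measure_display} {Omega : measurableType d}
    {R : realType} (P : probability Omega R) (F : R -> set (set Omega))
    (a b : R) (xi : step_process Omega R) : Prop :=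
  [/\ step_time xi 0 = a, step_time xi (step_size xi) = b,
      forall k, (k < step_size xi)%N -> step_time xi k <= step_time xi k.+1
    & forall k, (k < step_size xi)%N ->
        measurable_for (F (step_time xi k)) (step_val xi k) /\
        step_val xi k \in Lfun P 2%:E].

Definition step_fun {Omega : Type} {R : realType} (xi : step_process Omega R)
    (s : R) (x : Omega) : R :=
  \sum_(k < step_size xi)
    step_val xi k x * \1_(`[step_time xi k, step_time xi k.+1[) s.

Definition step_integral {Omega : Type} {R : realType} (W : R -> Omega -> R)
    (xi : step_process Omega R) (x : Omega) : R :=
  \sum_(k < step_size xi)
    step_val xi k x * (W (step_time xi k.+1) x - W (step_time xi k) x).

(* X is (a version of) the Ito integral of f over [a, b] with respect to the
   one-dimensional Wiener process W: the mean-square limit of the integrals of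
   adapted step processes approximating f. By the Ito isometry the limit is
   unique up to almost sure equality and does not depend on the approximating
   sequence. *)
Definition is_ito_integral {d : measure_display} {Omega : measurableType d}
    {R : realType} (P : probability Omega R) (F : R -> set (set Omega))
    (W : R -> Omega -> R) (a b : R) (f : R -> Omega -> R) (X : Omega -> R) :
    Prop :=
  ito_integrand P F a b f /\
  exists xi : nat -> step_process Omega R,
    [/\ forall n, step_adapted P F a b (xi n),
        (fun n => \int[lebesgue_measure]_(s in `[a, b])
           'E_P[fun x => ((step_fun (xi n) s x - f s x) ^+ 2)%R])%E @ \oo --> 0%E
      & mean_square_cvg P (fun n => step_integral W (xi n)) X].

(* X is the iterated integral \int_a^b \int_a^s dV_tau dW_s *)
Definition is_iterated_ito_integral {d : measure_display}
    {Omega : measurableType d} {R : realType} (P : probability Omega R)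
    (F : R -> set (set Omega)) (V W : R -> Omega -> R) (a b : R)
    (X : Omega -> R) : Prop :=
  exists J : R -> Omega -> R,
    (forall s : R, a <= s <= b ->
       is_ito_integral P F V a s (fun _ _ => 1) (J s)) /\
    is_ito_integral P F W a b J X.

(* Rodrigues' formula; legendre1 below gives the normalization P_j(1) = 1 *)
Definition legendre {R : realType} (j : nat) : {poly R} :=
  ((2 ^ j * j`!)%:R)^-1 *: (('X^2 - 1) ^+ j)^`(j).

Lemma derivn_XsubC_exp (R : realType) (n : nat) (c : R) (q : {poly R}) :
  ((('X - c%:P) ^+ n * q)^`(n)).[c] = n`!%:R * q.[c].
Proof.
elim: n q => [|n IHn] q; first by rewrite expr0 mul1r derivn0 mul1r.
have -> : (('X - c%:P) ^+ n.+1 * q)^`(n.+1) =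
    (('X - c%:P) ^+ n * (q *+ n.+1 + ('X - c%:P) * q^`()))^`(n).
  rewrite derivSn; congr derivn.
  rewrite derivM deriv_exp derivXsubC mul1r/= mulrDr.
  by rewrite (exprSr _ n) -[in LHS]mulrA mulrnAl mulrnAr.
rewrite IHn hornerD hornerMn hornerM hornerXsubC subrr mul0r addr0.
by rewrite factS natrM -(mulr_natl q.[c]) mulrCA mulrA.
Qed.

Lemma legendre1 (R : realType) (j : nat) : (legendre j : {poly R}).[1] = 1.
Proof.
rewrite /legendre hornerZ.
have -> : ('X^2 - 1 : {poly R}) ^+ j = ('X - 1%:P) ^+ j * ('X + 1%:P) ^+ j.
  by rewrite -exprMn -subr_sqr polyC1 expr1n.
rewrite derivn_XsubC_exp horner_exp hornerD hornerX hornerC.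
by rewrite natrM natrX [X in _ * X]mulrC mulVf// mulf_neq0//.
Qed.

(* the orthonormal Legendre system on [t, T] *)
Definition legendre_fun {R : realType} (t T : R) (j : nat) (s : R) : R :=
  Num.sqrt ((2 * j + 1)%:R / (T - t)) *
  (legendre j).[(s - t - (T - t) / 2) * (2 / (T - t))].

(* Main.v *)
Require Import Defs.
From mathcomp Require Import all_boot all_order all_algebra.
From mathcomp Require Import all_classical all_reals all_analysis.
From mathcomp Require Import measurable_realfun ring lra zify.
Set Implicit Arguments.
Unset Strict Implicit.
Unset Printing Implicit Defensive.
Import Order.TTheory GRing.Theory Num.Theory.
Import numFieldNormedType.Exports.
Local Open Scope classical_set_scope.
Local Open Scope ring_scope.

(** The Levy area is a double integral against the increments of the two
    independent components [w i1] and [w i2], with kernel [sgn (s - r) / 2] on the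
    square; the [j]-th term of the series is the double integral of the
    antisymmetric function [phi_(j-1) (r) phi_j (s) - phi_j (r) phi_(j-1) (s)]
    multiplied by a constant. For two independent components such double integrals
    are isometric to square integrable kernels. The series is therefore the Fourier
    expansion of the sign kernel along an orthogonal family, and the claim amounts
    to equality in Bessel's inequality. The primitive of a Legendre polynomial is
    essentially a combination of its two neighbours, so these are the only
    coefficients that do not vanish, and after [n] terms the square norm of the
    remainder is [(T - t)^2 / (4 (2 n + 1))] because [sum_(j <= n) 1 / (4 j^2 - 1)]
    telescopes to [n / (2 n + 1)].

    The proof carries this out on uniform grids, so that no theory of double
    stochastic integrals is needed. With [N + 1] intervals, the area and the
    products [zeta zeta] become finite bilinear sums of increments, and the error
    after [n] terms becomes a sum with kernel [levy_kernel N n / 2]. Its second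
    moment is computed exactly ([expect_bilinear_sum_sqr]), from the independence of
    the components and of the increments, and is a Riemann sum whose limit as [N]
    grows is the square norm above ([levy_kernel_cvg]); this uses only the
    orthogonality of Legendre polynomials, their norms and [legendre_prim0].

    It remains to compare the grid sums with the given stochastic integrals, which
    are limits of integrals of unspecified step processes. The Ito isometry for
    arbitrary finite families of adapted pieces ([ito_isometry]) yields
    [ito_approx]: the integral of [f] is as close to the integral of a chosen step
    process as [f] is to that process. So the grid sums converge in mean square, and
    their products converge in the mean ([expect_cvgM]). Since the second moment is
    lower semicontinuous for this convergence ([expect_sqr_le_cvg]), the error
    after [n] terms has second moment at most [(T - t)^2 / (4 (2 n + 1))], which
    tends to [0]. *)

(** * Expectation and square integrability *)

Section Expectation.
Context {d : measure_display} {T : measurableType d} {R : realType}.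
Variable P : probability T R.
Implicit Types X Y Z : T -> R.

Definition expect X : R := fine 'E_P[X]%E.

Local Notation L1 := (Lfun P 1).
Local Notation L2 := (Lfun P 2%:E).

Lemma expectE X : X \in L1 -> ('E_P[X] = (expect X)%:E)%E.
Proof. by move=> X1; rewrite fineK// expectation_fin_num. Qed.

Lemma L1_measurable X : X \in L1 -> measurable_fun [set: T] X.
Proof. by move=> /sub_Lfun_mfun; rewrite inE. Qed.

Lemma L2_measurable X : X \in L2 -> measurable_fun [set: T] X.
Proof. by move=> /sub_Lfun_mfun; rewrite inE. Qed.

Lemma L1D X Y : X \in L1 -> Y \in L1 -> (fun x => X x + Y x) \in L1.
Proof.
move=> /Lfun1_integrable X1 /Lfun1_integrable Y1; apply/Lfun1_integrable.
have := integrableD measurableT X1 Y1.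
by apply: eq_integrable.
Qed.

Lemma L1Z k X : X \in L1 -> (fun x => k * X x) \in L1.
Proof.
move=> /Lfun1_integrable X1; apply/Lfun1_integrable.
have := integrableZl measurableT k X1.
by apply: eq_integrable.
Qed.

Lemma L1N X : X \in L1 -> (fun x => - X x) \in L1.
Proof.
move=> X1; rewrite (_ : (fun _ => _) = (fun x => -1 * X x)); first exact: L1Z.
by apply/funext => x; rewrite mulN1r.
Qed.

Lemma L1B X Y : X \in L1 -> Y \in L1 -> (fun x => X x - Y x) \in L1.
Proof. by move=> X1 Y1; apply: L1D => //; exact: L1N. Qed.

Lemma L1_cst k : (fun=> k) \in L1.
Proof. exact: Lfun_cst. Qed.

Lemma L1_sum (I : Type) (s : seq I) (F : I -> T -> R) :
  (forall i, F i \in L1) -> (fun x => \sum_(i <- s) F i x) \in L1.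
Proof.
move=> F1; elim: s => [|i s IH].
  rewrite (_ : (fun _ => _) = fun=> 0); first exact: L1_cst.
  by apply/funext => x; rewrite big_nil.
rewrite (_ : (fun _ => _) = (fun x => F i x + \sum_(i <- s) F i x)).
  exact: L1D.
by apply/funext => x; rewrite big_cons.
Qed.

Lemma L1_norm X : X \in L1 -> (fun x => `|X x|) \in L1.
Proof. exact: Lfun_norm. Qed.

Lemma L1_dominated X Y : measurable_fun [set: T] X -> Y \in L1 ->
  (forall x, `|X x| <= Y x) -> X \in L1.
Proof.
move=> mX /Lfun1_integrable Y1 XY; apply/Lfun1_integrable.
apply: le_integrable Y1 => //; first exact/measurable_EFinP.
by move=> x _ /=; rewrite lee_fin (le_trans (XY x))// ler_norm.
Qed.

Lemma L2P X : X \in L2 <->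
  measurable_fun [set: T] X /\ (fun x => X x ^+ 2) \in L1.
Proof.
split=> [X2|[mX /Lfun1_integrable/integrableP[_ X2]]].
  by split; [exact: L2_measurable|exact/Lfun1_integrable/Lfun2_integrable_sqr].
apply/andP; split; rewrite inE//= /finite_norm unlock poweR_lty//.
apply: le_lt_trans X2; rewrite le_eqVlt; apply/orP; left; apply/eqP.
by apply: eq_integral => x _ /=; rewrite powR_mulrn// normrX.
Qed.

Lemma L2_sqr X : X \in L2 -> (fun x => X x ^+ 2) \in L1.
Proof. by move=> /L2P[]. Qed.

Lemma L2_L1 X : X \in L2 -> X \in L1.
Proof. by apply: Lfun_subset12; exact: fin_num_measure. Qed.

Lemma L2M X Y : X \in L2 -> Y \in L2 -> (fun x => X x * Y x) \in L1.
Proof. exact: Lfun2_mul_Lfun1. Qed.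

Lemma L2Z k X : X \in L2 -> (fun x => k * X x) \in L2.
Proof.
move=> /L2P[mX X2]; apply/L2P; split; first exact: measurable_funM.
rewrite (_ : (fun _ => _) = (fun x => k ^+ 2 * X x ^+ 2)); first exact: L1Z.
by apply/funext => x; rewrite exprMn.
Qed.

Lemma L2D X Y : X \in L2 -> Y \in L2 -> (fun x => X x + Y x) \in L2.
Proof.
move=> X2 Y2; apply/L2P; split.
  by apply: measurable_funD; exact: L2_measurable.
rewrite (_ : (fun _ => _) =
    (fun x => X x ^+ 2 + (2 * (X x * Y x) + Y x ^+ 2))); last first.
  by apply/funext => x; ring.
by apply: L1D; [exact: L2_sqr|apply: L1D; [exact/L1Z/L2M|exact: L2_sqr]].
Qed.

Lemma L2B X Y : X \in L2 -> Y \in L2 -> (fun x => X x - Y x) \in L2.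
Proof.
move=> X2 Y2; rewrite (_ : (fun _ => _) = (fun x => X x + -1 * Y x)).
  by apply: L2D => //; exact: L2Z.
by apply/funext => x; rewrite mulN1r.
Qed.

Lemma L2_cst k : (fun=> k) \in L2.
Proof. exact: Lfun_cst. Qed.

Lemma L2_sum (I : Type) (s : seq I) (F : I -> T -> R) :
  (forall i, F i \in L2) -> (fun x => \sum_(i <- s) F i x) \in L2.
Proof.
move=> F1; elim: s => [|i s IH].
  rewrite (_ : (fun _ => _) = fun=> 0); first exact: L2_cst.
  by apply/funext => x; rewrite big_nil.
rewrite (_ : (fun _ => _) = (fun x => F i x + \sum_(i <- s) F i x)).
  exact: L2D.
by apply/funext => x; rewrite big_cons.
Qed.

Lemma expectD X Y : X \in L1 -> Y \in L1 ->
  expect (fun x => X x + Y x) = expect X + expect Y.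
Proof.
by move=> X1 Y1; apply: EFin_inj; rewrite -expectE ?L1D//
  [LHS](expectationD X1 Y1) !expectE.
Qed.

Lemma expectZ k X : X \in L1 -> expect (fun x => k * X x) = k * expect X.
Proof.
move=> X1; apply: EFin_inj; rewrite -expectE ?L1Z// EFinM -expectE//.
rewrite -expectationZl//; congr ('E_P[_])%E.
by apply/funext => x /=; rewrite mulrC.
Qed.

Lemma expectB X Y : X \in L1 -> Y \in L1 ->
  expect (fun x => X x - Y x) = expect X - expect Y.
Proof.
move=> X1 Y1; rewrite (_ : (fun _ => _) = (fun x => X x + -1 * Y x)).
  by rewrite expectD ?L1Z// expectZ// mulN1r.
by apply/funext => x; rewrite mulN1r.
Qed.

Lemma expect_cst k : expect (fun=> k) = k.
Proof. by rewrite /expect (expectation_cst P k). Qed.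

Lemma expect_sum (I : Type) (s : seq I) (F : I -> T -> R) :
  (forall i, F i \in L1) ->
  expect (fun x => \sum_(i <- s) F i x) = \sum_(i <- s) expect (F i).
Proof.
move=> F1; elim: s => [|i s IH].
  rewrite big_nil -[RHS](expect_cst 0); congr expect.
  by apply/funext => x; rewrite big_nil.
rewrite big_cons -IH -expectD ?L1_sum//; congr expect.
by apply/funext => x; rewrite big_cons.
Qed.

Lemma expect_ge0 X : (forall x, 0 <= X x) -> 0 <= expect X.
Proof. by move=> X0; rewrite fine_ge0// expectation_ge0. Qed.

Lemma expect_le X Y : X \in L1 -> Y \in L1 -> (forall x, X x <= Y x) ->
  expect X <= expect Y.
Proof.
move=> X1 Y1 XY; rewrite -subr_ge0 -expectB//.
by apply: expect_ge0 => x; rewrite subr_ge0.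
Qed.

Lemma expect_norm X : X \in L1 -> `|expect X| <= expect (fun x => `|X x|).
Proof.
move=> X1; rewrite ler_norml; apply/andP; split.
  rewrite -[leLHS]mulN1r -expectZ ?L1_norm// expect_le ?L1Z ?L1_norm//.
  by move=> x; rewrite mulN1r lerNl -normrN ler_norm.
by rewrite expect_le ?L1_norm// => x; rewrite ler_norm.
Qed.

Lemma expect_ae_eq X Y : measurable_fun [set: T] X ->
  measurable_fun [set: T] Y -> {ae P, forall x, X x = Y x} ->
  'E_P[X]%E = 'E_P[Y]%E.
Proof.
move=> mX mY XY; rewrite unlock; apply: ae_eq_integral => //.
- exact/measurable_EFinP.
- exact/measurable_EFinP.
- by apply: filterS XY => x /= -> _.
Qed.

Lemma expect_sqr_eq0 X : X \in L2 -> expect (fun x => X x ^+ 2) = 0 ->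
  {ae P, forall x, X x = 0}.
Proof.
move=> X2 EX; have mX := L2_measurable X2.
have : (\int[P]_x `|(X x ^+ 2)%:E| = 0)%E.
  transitivity ('E_P[fun x => (X x ^+ 2)%R])%E; last first.
    by rewrite expectE ?L2_sqr// EX.
  by rewrite unlock; apply: eq_integral => x _; rewrite gee0_abs// lee_fin sqr_ge0.
move=> /ae_eq_integral_abs.
have mX2 : measurable_fun [set: T] (fun x => (X x ^+ 2)%:E).
  by apply/measurable_EFinP; exact: measurable_funX.
move=> /(_ measurableT mX2); apply: filterS => x /(_ Logic.I) /= [].
by move/eqP; rewrite sqrf_eq0 => /eqP.
Qed.

Definition norm2 X : R := Num.sqrt (expect (fun x => X x ^+ 2)).

Lemma expect_sqr_ge0 X : 0 <= expect (fun x => X x ^+ 2).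
Proof. by apply: expect_ge0 => x; exact: sqr_ge0. Qed.

Lemma norm2_sqr X : norm2 X ^+ 2 = expect (fun x => X x ^+ 2).
Proof. by rewrite sqr_sqrtr// expect_sqr_ge0. Qed.

(** The quadratic polynomial [s |-> E (|X| - s |Y|)^2] is nonnegative; its value
    at the minimum gives the inequality. *)
Lemma cauchy_schwarz X Y : X \in L2 -> Y \in L2 ->
  expect (fun x => `|X x * Y x|) <= norm2 X * norm2 Y.
Proof.
move=> X2 Y2; set c := expect _.
have c0 : 0 <= c by exact: expect_ge0.
have XY1 := L1_norm (L2M X2 Y2).
have q s : 0 <= norm2 X ^+ 2 - 2 * s * c + s ^+ 2 * norm2 Y ^+ 2.
  rewrite !norm2_sqr -!expectZ// ?L2_sqr// -expectB ?L1Z ?L2_sqr//.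
  rewrite -expectD ?L1B ?L1Z ?L2_sqr//; apply: expect_ge0 => x.
  rewrite normrM -(real_normK (num_real (X x))) -(real_normK (num_real (Y x))).
  by rewrite [leRHS](_ : _ = (`|X x| - s * `|Y x|) ^+ 2) ?sqr_ge0//; ring.
have nX : 0 <= norm2 X by exact: sqrtr_ge0.
have nY : 0 <= norm2 Y by exact: sqrtr_ge0.
have [Y0|Y0] := eqVneq (norm2 Y) 0; last first.
  have := q (c / norm2 Y ^+ 2); rewrite -(ler_pM2r (_ : 0 < norm2 Y ^+ 2)).
    rewrite mul0r [leRHS](_ : _ = (norm2 X * norm2 Y) ^+ 2 - c ^+ 2).
      by rewrite subr_ge0 ler_sqr// nnegrE// mulr_ge0.
    by field.
  by rewrite exprn_gt0// lt_neqAle eq_sym Y0.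
rewrite Y0 mulr0; have [//|cgt0] := leP c 0.
(* when Y vanishes the polynomial is affine, and this s makes it equal to -1 *)
have := q ((norm2 X ^+ 2 + 1) / (2 * c)); rewrite Y0.
rewrite [leRHS](_ : _ = -1) ?ler0N1//.
by field; rewrite gt_eqF.
Qed.

(** Cauchy-Schwarz applied to the three terms of
    [XY - X0 Y0 = (X - X0) Y0 + X0 (Y - Y0) + (X - X0) (Y - Y0)]. Convergence in
    the mean is all that can be expected of a product, and it is enough for
    [expect_sqr_le_cvg]. *)
Lemma expect_cvgM (X Y : nat -> T -> R) (X0 Y0 : T -> R) :
  (forall n, X n \in L2) -> (forall n, Y n \in L2) -> X0 \in L2 -> Y0 \in L2 ->
  norm2 (fun x => X n x - X0 x) @[n --> \oo] --> 0 ->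
  norm2 (fun x => Y n x - Y0 x) @[n --> \oo] --> 0 ->
  expect (fun x => `|X n x * Y n x - X0 x * Y0 x|) @[n --> \oo] --> 0.
Proof.
move=> X2 Y2 X02 Y02 cX cY.
pose u n := norm2 (fun x => X n x - X0 x).
pose v n := norm2 (fun x => Y n x - Y0 x).
apply: (@squeeze_cvgr _ _ _ _ (fun=> 0)
  (fun n => u n * norm2 Y0 + (norm2 X0 * v n + u n * v n))).
- apply: nearW => n; apply/andP; split; first exact: expect_ge0.
  have dX : (fun x => X n x - X0 x) \in L2 by exact: L2B.
  have dY : (fun x => Y n x - Y0 x) \in L2 by exact: L2B.
  apply: (@le_trans _ _ (expect (fun x => `|(X n x - X0 x) * Y0 x| +
    (`|X0 x * (Y n x - Y0 x)| + `|(X n x - X0 x) * (Y n x - Y0 x)|)))).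
    apply: expect_le.
    - by apply/L1_norm/L1B; exact: L2M.
    - apply: L1D; first by apply/L1_norm/L2M.
      by apply: L1D; apply/L1_norm/L2M.
    - move=> x; rewrite (_ : X n x * Y n x - X0 x * Y0 x =
        (X n x - X0 x) * Y0 x + (X0 x * (Y n x - Y0 x) +
          (X n x - X0 x) * (Y n x - Y0 x))); last by ring.
      by apply: le_trans (ler_normD _ _) _; rewrite lerD2l ler_normD.
  rewrite expectD ?L1D ?L1_norm ?L2M// expectD ?L1_norm ?L2M//.
  by rewrite !lerD// cauchy_schwarz.
- exact: cvg_cst.
- rewrite [X in _ --> X](_ : 0 = 0 * norm2 Y0 + (norm2 X0 * 0 + 0 * 0)).
    apply: cvgD; first by apply: cvgM => //; exact: cvg_cst.
    apply: cvgD; last exact: cvgM.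
    by apply: cvgM => //; exact: cvg_cst.
  by ring.
Qed.

(** The second moment is lower semicontinuous for convergence in the mean. The
    truncation [y |-> min(|y|, M)^2] is [2M]-Lipschitz, so the bound passes to the
    limit at each level [M]; then [M] tends to infinity by monotone convergence.
    Square integrability of the limit comes for free. *)
Lemma expect_sqr_le_cvg (X : nat -> T -> R) (Y : T -> R) (c : nat -> R) (l : R) :
  (forall n, X n \in L2) -> Y \in L1 ->
  expect (fun x => `|X n x - Y x|) @[n --> \oo] --> 0 ->
  (forall n, expect (fun x => X n x ^+ 2) <= c n) -> c @ \oo --> l ->
  Y \in L2 /\ expect (fun x => Y x ^+ 2) <= l.
Proof.
move=> X2 Y1 XY Xc cl.
have mY := L1_measurable Y1.
pose g (M : nat) (y : R) := Num.min `|y| M%:R.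
have g0 M y : 0 <= g M y by rewrite /g le_min normr_ge0 /=.
have gM M y : g M y <= M%:R by rewrite /g ge_min lexx orbT.
have gy M y : g M y <= `|y| by rewrite /g ge_min lexx.
have gL M y z : `|g M y - g M z| <= `|y - z|.
  apply: le_trans (ler_dist_dist y z).
  rewrite /g; have [a|a] := leP `|y| M%:R; have [b|b] := leP `|z| M%:R => //.
  - by rewrite ler_norml; move: a b => a b; apply/andP; split;
      have := ler_norm (`|y| - `|z|); have := ler_norm (- (`|y| - `|z|));
      rewrite normrN; lra.
  - by rewrite ler_norml; move: a b => a b; apply/andP; split;
      have := ler_norm (`|y| - `|z|); have := ler_norm (- (`|y| - `|z|));
      rewrite normrN; lra.
  - by rewrite subrr normr0.
have mg M Z : measurable_fun [set: T] Z -> measurable_fun [set: T] (fun x => g M (Z x) ^+ 2).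
  move=> mZ; apply: measurable_funX; apply: measurable_minr => //.
  exact: measurableT_comp.
have gE M y : `|g M y ^+ 2| <= M%:R ^+ 2.
  by rewrite ger0_norm ?sqr_ge0// ler_pXn2r// nnegrE.
have g1 M Z : measurable_fun [set: T] Z -> (fun x => g M (Z x) ^+ 2) \in L1.
  by move=> mZ; apply: (L1_dominated (mg _ _ mZ) (L1_cst _)).
have key M : expect (fun x => g M (Y x) ^+ 2) <= l.
  pose h n := c n + 2 * M%:R * expect (fun x => `|X n x - Y x|).
  apply: (@cvgr_to_ge nat \oo _ R h).
  - rewrite [X in _ --> X](_ : l = l + 2 * M%:R * 0); last by rewrite mulr0 addr0.
    by apply: cvgD => //; apply: cvgM => //; exact: cvg_cst.
  - apply: nearW => n; have mX := L2_measurable (X2 n).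
    have D1 : (fun x => `|X n x - Y x|) \in L1.
      by apply/L1_norm/L1B => //; exact: L2_L1.
    apply: (@le_trans _ _ (expect (fun x => X n x ^+ 2 + 2 * M%:R * `|X n x - Y x|))).
      apply: expect_le; first exact: g1.
        by apply: L1D; [exact: L2_sqr|exact: L1Z].
      move=> x; apply: (@le_trans _ _ (g M (X n x) ^+ 2 + 2 * M%:R * `|X n x - Y x|)).
        have := gL M (X n x) (Y x).
        have := gM M (X n x); have := gM M (Y x); have := g0 M (X n x).
        have := g0 M (Y x).
        move: (g M (X n x)) (g M (Y x)) `|X n x - Y x| (M%:R : R) => a b e m b0 a0 bm am.
        rewrite ler_norml => /andP[h1 h2].
        have : (b - a) * (a + b) <= e * (2 * m) by nra.
        by nra.
      rewrite lerD2r -(real_normK (num_real (X n x))) ler_pXn2r// nnegrE//.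
    by rewrite expectD ?L2_sqr ?L1Z// expectZ// lerD2r.
have l0 : 0 <= l by apply: le_trans (key 0%N); exact: expect_sqr_ge0.
have bound : ('E_P[fun x => (Y x ^+ 2)%R] <= l%:E)%E.
  have -> : ('E_P[fun x => (Y x ^+ 2)%R] =
      \int[P]_x (limn (fun M => (g M (Y x) ^+ 2)%:E)))%E.
    rewrite unlock; apply: eq_integral => x _; apply/esym/cvg_lim => //.
    apply: cvg_near_cst; exists (Num.truncn `|Y x|).+1 => // M /= YM.
    rewrite /g min_l ?real_normK ?num_real//.
    rewrite (le_trans (ltW (truncnS_gt _)))// ler_nat//.
  rewrite monotone_convergence//.
  - apply: lime_le.
      apply: ereal_nondecreasing_is_cvgn => M N MN; apply: ge0_le_integral => //.
      - by move=> x _; rewrite lee_fin sqr_ge0.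
      - exact/measurable_EFinP/mg.
      - exact/measurable_EFinP/mg.
      - move=> x _; rewrite lee_fin ler_pXn2r ?nnegrE ?g0//.
        by rewrite /g le_min gy/= ge_min ler_nat MN orbT.
    apply: nearW => M; have := key M; rewrite -lee_fin -expectE ?g1//.
    by rewrite unlock.
  - by move=> M; exact/measurable_EFinP/mg.
  - by move=> M x _; rewrite lee_fin sqr_ge0.
  - move=> x _ M N MN; rewrite lee_fin ler_pXn2r ?nnegrE ?g0//.
    by rewrite /g le_min gy/= ge_min ler_nat MN orbT.
have Y2 : Y \in L2.
  apply/L2P; split => //; apply/Lfun1_integrable/integrableP; split.
    by apply/measurable_EFinP; exact: measurable_funX.
  apply: (@le_lt_trans _ _ l%:E); last exact: ltry.
  apply: le_trans bound; rewrite unlock le_eqVlt; apply/orP; left; apply/eqP.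
  by apply: eq_integral => x _ /=; rewrite ger0_norm// sqr_ge0.
by split=> //; rewrite -lee_fin -expectE ?L2_sqr.
Qed.

End Expectation.

(** * Moments of the centred normal law *)

Lemma FTC_is_derive (R : realType) (f F : R -> R) (a b : R) : a < b ->
  continuous f -> (forall x : R, is_derive x (1 : R) F (f x)) ->
  (\int[lebesgue_measure]_(x in `[a, b]) (f x)%:E = (F b - F a)%:E)%E.
Proof.
move=> ab cf dF; have cF : continuous F.
  by move=> x; apply/differentiable_continuous/derivable1_diffP; case: (dF x).
rewrite (@continuous_FTC2 _ f F)//.
- by apply/continuous_subspaceT => x; exact: cf.
- split=> [x _| |].
  + by case: (dF x).
  + by apply: cvg_at_right_filter; exact: cF.
  + by apply: cvg_at_left_filter; exact: cF.
- by move=> x _; rewrite derive1E; exact: derive_val.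
Qed.

Section NormalMoments.
Context {R : realType}.
Variable sigma : R.
Hypothesis sigma0 : 0 < sigma.

Let p := normal_pdf 0 sigma.
Let mu := @lebesgue_measure R.
Let A (n : nat) : set R := `[- n.+1%:R, n.+1%:R].

Let pE x : p x = normal_peak sigma * expR (- (x ^+ 2 / (sigma ^+ 2 *+ 2))).
Proof. by rewrite /p normal_pdfE ?gt_eqF// /normal_fun subr0 mulNr. Qed.

Let is_derive_p (x : R) : is_derive x (1 : R) p (- (x / sigma ^+ 2) * p x).
Proof.
have -> : p = (fun x => normal_peak sigma * (expR \o
    (fun x => - (sigma ^+ 2 *+ 2)^-1 * x ^+ 2)) x).
  by apply/funext => y; rewrite pE /=; congr (_ * expR _); ring.
pose c := (sigma ^+ 2 *+ 2)^-1.
have d1 : is_derive x (1 : R) (fun x => - c * x ^+ 2) (- c * (2 * x)).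
  by apply: is_derive_eq; rewrite /GRing.scale/= ; ring.
have d2 := is_derive1_comp (is_derive_expR _) d1.
have d3 := is_deriveZ (normal_peak sigma) d2.
apply: is_derive_eq; rewrite /GRing.scale/= /c; field.
by rewrite gt_eqF.
Qed.

Let p_ge0 x : 0 <= p x. Proof. exact: normal_pdf_ge0. Qed.

Let continuous_p : continuous p.
Proof. by apply: continuous_normal_pdf; rewrite gt_eqF. Qed.

(** The boundary term of the integration by parts giving the second moment. *)
Let p_tail : (fun n : nat => n.+1%:R * p n.+1%:R) @ \oo --> (0 : R).
Proof.
pose k := normal_peak sigma; pose c := (sigma ^+ 2 *+ 2)^-1.
have k0 : 0 < k by apply: normal_peak_gt0; rewrite gt_eqF.
have c0 : 0 < c by rewrite invr_gt0 pmulrn_lgt0// exprn_gt0.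
apply: (@squeeze_cvgr _ _ _ _ (fun=> 0) (fun n => (k / c) * harmonic n)).
- apply: nearW => n; rewrite mulr_ge0//= pE -/k -/c expRN.
  have n0 : 0 < n.+1%:R :> R by [].
  rewrite /harmonic; set y : R := n.+1%:R in n0 *.
  have e0 : 0 < expR (y ^+ 2 * c) by exact: expR_gt0.
  have : y ^+ 2 * c <= expR (y ^+ 2 * c).
    by apply: le_trans (expR_ge1Dx _); rewrite lerDr.
  move=> H; rewrite mulrCA -[leRHS]mulrA ler_pM2l//.
  move: (expR _) e0 H c0 => e e0 H c0.
  rewrite -subr_ge0 (_ : _ - _ = (e - y ^+ 2 * c) / (c * (y * e))).
    by rewrite divr_ge0 ?subr_ge0// mulr_ge0 ?mulr_ge0// ltW.
  by field; rewrite !gt_eqF.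
- exact: cvg_cst.
- rewrite -[X in _ --> X](mulr0 (k / c)); apply: cvgM; first exact: cvg_cst.
  exact: cvg_harmonic.
Qed.

Let nu := normal_prob 0 sigma.

Let nuT : (nu [set: R] = 1)%E.
Proof. exact: (@probability_setT _ _ _ (normal_prob 0 sigma)). Qed.

(** The density [p] is the Radon-Nikodym derivative of [nu]; this is applied on
    the bounded intervals [A n], where the moments are visibly integrable. *)
Let integral_nu f n : continuous f -> (forall x, A n x -> `|f x| <= n.+1%:R ^+ 2) ->
  (\int[nu]_(x in A n) (f x)%:E = \int[mu]_(x in A n) (f x * p x)%:E)%E.
Proof.
move=> cf fn; have mf : measurable_fun (A n) f.
  by apply: measurable_funTS; exact: continuous_measurable_fun.
have mA : measurable (A n) by exact: measurable_itv.
have intf : nu.-integrable (A n) (EFin \o f).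
  apply: measurable_bounded_integrable => //.
    by rewrite -ge0_fin_numE ?fin_num_measure.
  exists (n.+1%:R ^+ 2); split; first by rewrite num_real.
  by move=> M nM x /= /fn /le_trans -> //; exact: ltW.
have dom := @normal_prob_dominates R 0 sigma.
rewrite -(Radon_Nikodym_change_of_variables dom mA intf).
apply: ae_eq_integral => //.
- apply: emeasurable_funM; first exact/measurable_EFinP.
  apply: (measurable_int mu); apply: (integrableS _ _ (@subsetT _ _)) => //=.
  exact: Radon_Nikodym_integrable.
- apply/measurable_EFinP; apply: measurable_funM => //.
  by apply: measurable_funTS; exact: measurable_normal_pdf.
- rewrite (_ : (fun x => (f x * p x)%:E) = (fun x => (f x)%:E * (p x)%:E)%E)//.
  apply: ae_eqe_mul2l => /=.
  rewrite Radon_NikodymE//=.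
  case: cid => /= h [h1 h2 h3].
  apply: integral_ae_eq => //=.
  + exact: integrableS h2.
  + by apply/measurable_funTS/measurableT_comp =>//; exact: measurable_normal_pdf.
  + by move=> E E01 mE; rewrite -h3.
Qed.

Let bigcupA : \bigcup_n A n = [set: R].
Proof.
apply/seteqP; split=> // x _; exists (Num.truncn `|x|) => //=.
by rewrite /A/= in_itv/= -ler_norml ltW// truncnS_gt.
Qed.

Let homoA : {homo A : n m / (n <= m)%N >-> (n <= m)%O}.
Proof.
move=> n m nm; rewrite subsetEset => x; rewrite /A/= !in_itv/= -!ler_norml.
by move=> /le_trans; apply; rewrite ler_nat.
Qed.

(** The primitive [- sigma^2 p] of [x p] is even. *)
Let integral_mean n : (\int[nu]_(x in A n) x%:E = 0)%E.
Proof.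
rewrite integral_nu//; last 2 first.
- by move=> x; exact: cvg_id.
- move=> x; rewrite /A/= in_itv/= -ler_norml => /le_trans; apply.
  by rewrite expr2 ler_peMr// ler1n.
have nn : - n.+1%:R < n.+1%:R :> R by rewrite gtrN.
have cf : continuous (fun x : R => x * p x).
  by move=> x; apply: cvgM; [exact: cvg_id|exact: continuous_p].
have dF (x : R) : is_derive x (1 : R) (fun x => - (sigma ^+ 2 * p x)) (x * p x).
  have d1 := is_deriveN (is_deriveZ (sigma ^+ 2) (is_derive_p x)).
  apply: is_derive_eq; rewrite /GRing.scale/=; field.
  by rewrite gt_eqF.
by rewrite (FTC_is_derive nn cf dF) !pE sqrrN subrr.
Qed.

(** [- sigma^2 x p] is a primitive of [(x^2 - sigma^2) p]. *)
Let integral_sqr n : (\int[nu]_(x in A n) (x ^+ 2)%:E =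
  (sigma ^+ 2)%:E * nu (A n) - (2 * sigma ^+ 2 * (n.+1%:R * p n.+1%:R))%:E)%E.
Proof.
have cx2 : continuous (fun x : R => x ^+ 2) by exact: sqr_continuous.
rewrite integral_nu//; last first.
  move=> x; rewrite /A/= in_itv/= -ler_norml => xn.
  by rewrite normrX ler_pXn2r ?nnegrE.
have mA : measurable (A n) by exact: measurable_itv.
have ip : mu.-integrable (A n) (EFin \o p).
  by apply: (integrableS measurableT) => //; exact: integrable_normal_pdf.
have ia : mu.-integrable (A n) (EFin \o (fun x => (x ^+ 2 - sigma ^+ 2) * p x)).
  apply: continuous_compact_integrable; first exact: segment_compact.
  apply: continuous_subspaceT => x; apply: cvgM; last exact: continuous_p.
  by apply: cvgB; [exact: cx2|exact: cvg_cst].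
have E : (\int[mu]_(x in A n) ((x ^+ 2 - sigma ^+ 2) * p x)%:E =
    (- (2 * sigma ^+ 2 * (n.+1%:R * p n.+1%:R)))%:E)%E.
  have nn : - n.+1%:R < n.+1%:R :> R by rewrite gtrN.
  have cf : continuous (fun x : R => (x ^+ 2 - sigma ^+ 2) * p x).
    move=> x; apply: cvgM; last exact: continuous_p.
    by apply: cvgB; [exact: cx2|exact: cvg_cst].
  have dF (x : R) : is_derive x (1 : R) (fun x => - (sigma ^+ 2 * (x * p x)))
      ((x ^+ 2 - sigma ^+ 2) * p x).
    have d0 := is_deriveM (is_derive_id x (1 : R)) (is_derive_p x).
    have d1 := is_deriveN (is_deriveZ (sigma ^+ 2) d0).
    apply: is_derive_eq; rewrite /GRing.scale/=; field.
    by rewrite gt_eqF.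
  by rewrite (FTC_is_derive nn cf dF) !pE sqrrN; congr EFin; ring.
rewrite -EFinN -E addeC [in RHS]/nu /normal_prob -integralZl//.
rewrite -integralD//; last exact: integrableZl.
apply: eq_integral => x _ /=; rewrite -EFinM -EFinD -/(p x); congr EFin.
by move: (p x) => y; ring.
Qed.

Lemma normal_second_moment : (\int[nu]_x (x ^+ 2)%:E = (sigma ^+ 2)%:E)%E.
Proof.
have c1 : ((\int[nu]_(x in A n) (x ^+ 2)%:E)%E @[n --> \oo] -->
    (\int[nu]_x (x ^+ 2)%:E)%E).
  rewrite -bigcupA; apply: ge0_nondecreasing_set_cvg_integral => //.
  - by move=> n; exact: measurable_itv.
  - move=> n; apply/measurable_EFinP; apply: measurable_funTS.
    by apply: continuous_measurable_fun; exact: sqr_continuous.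
  - by move=> n x _; rewrite lee_fin sqr_ge0.
have c2 : (nu (A n) @[n --> \oo] --> 1%:E)%E.
  rewrite -nuT -bigcupA.
  apply: nondecreasing_cvg_mu => //.
  - by move=> n; exact: measurable_itv.
  - by apply: bigcup_measurable => n _; exact: measurable_itv.
have c3 : ((sigma ^+ 2)%:E * nu (A n) -
    (2 * sigma ^+ 2 * (n.+1%:R * p n.+1%:R))%:E @[n --> \oo] -->
    (sigma ^+ 2)%:E * 1 - (2 * sigma ^+ 2 * 0)%:E)%E.
  apply: cvgeB => //; first exact: cvgeZl.
  by apply/cvg_EFin; [exact: nearW|apply: cvgM => //; exact: cvg_cst].
rewrite (funext integral_sqr) in c1.
by rewrite -(cvg_lim _ c1)// (cvg_lim _ c3)// mule1 mulr0 sube0.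
Qed.

Lemma normal_mean : (\int[nu]_x x%:E = 0)%E.
Proof.
have mA n : measurable (A n) by exact: measurable_itv.
have mid : measurable_fun [set: R] (fun x : R => x%:E).
  exact: EFin_measurable.
have := @dominated_convergence _ _ _ nu setT measurableT
  (fun n => (fun x => x%:E) \_ (A n)) (fun x => x%:E) (fun x => (1 + x ^+ 2)%:E).
case.
- move=> n; apply/(measurable_restrictT _ (mA n)).
  exact: measurable_funTS.
- exact: mid.
- apply/aeW => x _; apply: cvg_near_cst.
  exists (Num.truncn `|x|) => // n /= xn.
  rewrite patchE ifT// inE /A/= in_itv/= -ler_norml.
  by rewrite (le_trans (ltW (truncnS_gt _)))// ler_nat.
- have msq : measurable_fun [set: R] (fun x : R => (x ^+ 2)%:E).
    by apply/measurable_EFinP; apply: continuous_measurable_fun; exact: sqr_continuous.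
  have i2 : nu.-integrable [set: R] (fun x : R => (x ^+ 2)%:E).
    apply/integrableP; split=> //.
    under eq_integral do rewrite gee0_abs ?lee_fin ?sqr_ge0//.
    by rewrite normal_second_moment ltry.
  have i1 := @finite_measure_integrable_cst _ _ _ (normal_prob 0 sigma) setT 1.
  have := integrableD measurableT (i1 measurableT) i2.
  by apply: eq_integrable.
- apply/aeW => x n _; rewrite patchE; case: ifPn => _.
    rewrite /= lee_fin -(real_normK (num_real x)).
    by have := sqr_ge0 (`|x| - 1); have := normr_ge0 x; nra.
  by rewrite abse0 lee_fin addr_ge0 ?sqr_ge0.
move=> _ _ c.
rewrite -(cvg_lim _ c)//=; apply/cvg_lim => //.
apply: cvg_near_cst; apply: nearW => n.
by rewrite -integral_mkcond integral_mean.
Qed.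

Context {d : measure_display} {T : measurableType d}.
Variables (P : probability T R) (X : T -> R).
Hypothesis mX : measurable_fun [set: T] X.
Hypothesis XN : forall B, measurable B -> P (X @^-1` B) = normal_prob 0 sigma B.

Let X' : {RV P >-> measurableTypeR R} :=
  @mfun_Sub _ _ T (measurableTypeR R) X (mem_set mX).

(** [XN] says that the law of [X] is [nu], so that expectations of functions of
    [X] are integrals against [nu]. *)
Let integral_nuX (f : R -> \bar R) :
  (\int[nu]_x f x = \int[distribution P X']_x f x)%E.
Proof.
apply: (@eq_measure_integral _ (measurableTypeR R) _ setT (distribution P X')
  (normal_prob 0 sigma) f) => B mB _.
by rewrite [RHS]XN.
Qed.

Let expect_sqr : ('E_P[fun x => (X x ^+ 2)%R] = (sigma ^+ 2)%:E)%E.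
Proof.
rewrite -normal_second_moment integral_nuX ge0_integral_distribution//.
- by rewrite unlock.
- apply/measurable_EFinP.
  by apply: continuous_measurable_fun; exact: sqr_continuous.
- by move=> x; rewrite lee_fin sqr_ge0.
Qed.

Lemma normal_L2 : X \in Lfun P 2%:E.
Proof.
apply/L2P; split=> //; apply/Lfun1_integrable/integrableP; split.
  by apply/measurable_EFinP; exact: measurable_funX.
under eq_integral do rewrite gee0_abs ?lee_fin ?sqr_ge0//.
by have := expect_sqr; rewrite unlock => ->; rewrite ltry.
Qed.

Lemma normal_expect_sqr : expect P (fun x => X x ^+ 2) = sigma ^+ 2.
Proof. by rewrite /expect expect_sqr. Qed.

Lemma normal_expect : expect P X = 0.
Proof.
have := normal_mean; rewrite integral_nuX integral_distribution.
- by rewrite /expect unlock => ->.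
- exact: EFin_measurable.
- by apply/Lfun1_integrable; apply: L2_L1; exact: normal_L2.
Qed.

End NormalMoments.

(** * Expectation of products of independent variables *)

Section Independence.
Context {d : measure_display} {T : measurableType d} {R : realType}.
Variables (P : probability T R) (X Y : T -> R).
Hypotheses (mX : measurable_fun [set: T] X) (mY : measurable_fun [set: T] Y).
Hypothesis XY : forall A B : set R, measurable A -> measurable B ->
  P (X @^-1` A `&` Y @^-1` B) = (P (X @^-1` A) * P (Y @^-1` B))%E.

Let X' : {RV P >-> measurableTypeR R} :=
  @mfun_Sub _ _ T (measurableTypeR R) X (mem_set mX).
Let Y' : {RV P >-> measurableTypeR R} :=
  @mfun_Sub _ _ T (measurableTypeR R) Y (mem_set mY).

Let mXY : measurable_fun [set: T]
  (fun x => (X x, Y x) : measurableTypeR R * measurableTypeR R).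
Proof. exact: measurable_fun_pair. Qed.

Let Z' : {RV P >-> (measurableTypeR R * measurableTypeR R)%type} :=
  @mfun_Sub _ _ T (measurableTypeR R * measurableTypeR R)%type _ (mem_set mXY).

Let lX := distribution P X'.
Let lY := distribution P Y'.
Let f (z : measurableTypeR R * measurableTypeR R) : \bar R := (z.1 * z.2)%:E.

Let mf : measurable_fun setT f.
Proof. by apply/measurable_EFinP; exact: measurable_funM. Qed.

(** Independence on rectangles determines the joint law; products of expectations
    are then obtained from Fubini's theorem. *)
Let law_prod (A : set (measurableTypeR R * measurableTypeR R)) :
  measurable A -> (lX \x lY)%E A = distribution P Z' A.
Proof. by apply: product_measure_unique => B C mB mC; exact: XY. Qed.

Let integralXE (g : R -> R) : measurable_fun setT g -> X \in Lfun P 1 ->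
  (forall y, `|g y| <= `|y|) -> (\int[lX]_x (g x)%:E = 'E_P[g \o X])%E.
Proof.
move=> mg X1 gy; rewrite (@integral_distribution _ _ _ _ _ P X').
- by rewrite unlock.
- exact/measurable_EFinP.
- apply/Lfun1_integrable/(L1_dominated _ (L1_norm X1)) => //.
  exact: measurableT_comp.
Qed.

Let integralYE (g : R -> R) : measurable_fun setT g -> Y \in Lfun P 1 ->
  (forall y, `|g y| <= `|y|) -> (\int[lY]_x (g x)%:E = 'E_P[g \o Y])%E.
Proof.
move=> mg X1 gy; rewrite (@integral_distribution _ _ _ _ _ P Y').
- by rewrite unlock.
- exact/measurable_EFinP.
- apply/Lfun1_integrable/(L1_dominated _ (L1_norm X1)) => //.
  exact: measurableT_comp.
Qed.

Hypotheses (X1 : X \in Lfun P 1) (Y1 : Y \in Lfun P 1).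

Let mnorm : measurable_fun [set: R] (fun x : R => `|x|).
Proof. exact: measurableT_comp. Qed.

Let intf : (lX \x lY)%E.-integrable setT f.
Proof.
apply/integrable12ltyP => //.
pose a := expect P (fun x => `|X x|); pose b := expect P (fun x => `|Y x|).
have E (x : R) : (\int[lY]_y `|f (x, y)| = (b * `|x|)%:E)%E.
  under eq_integral do rewrite /f /= normrM EFinM.
  rewrite ge0_integralZl//.
  - rewrite (@integralYE (fun y => `|y|))// => [|y]; last by rewrite normr_id.
    by rewrite expectE ?L1_norm// -EFinM mulrC.
  - exact/measurable_EFinP.
under eq_integral do rewrite E EFinM.
rewrite ge0_integralZl//.
- rewrite (@integralXE (fun y => `|y|))// => [|y]; last by rewrite normr_id.
  by rewrite expectE ?L1_norm// -EFinM ltry.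
- exact/measurable_EFinP.
- by rewrite lee_fin expect_ge0.
Qed.

Let int_lX : lX.-integrable setT (fun x : measurableTypeR R => x%:E).
Proof.
apply/integrableP; split; first exact: EFin_measurable.
rewrite (@integralXE (fun y => `|y|))// => [|y]; last by rewrite normr_id.
by rewrite expectE ?L1_norm// ltry.
Qed.

Let int_lY : lY.-integrable setT (fun x : measurableTypeR R => x%:E).
Proof.
apply/integrableP; split; first exact: EFin_measurable.
rewrite (@integralYE (fun y => `|y|))// => [|y]; last by rewrite normr_id.
by rewrite expectE ?L1_norm// ltry.
Qed.

Lemma independent_L1M : (fun x => X x * Y x) \in Lfun P 1.
Proof.
apply/Lfun1_integrable/integrableP; split.
  by apply/measurable_EFinP; exact: measurable_funM.
have /integrableP[_] := intf.
rewrite (@eq_measure_integral _ _ _ setT (distribution P Z')); last first.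
  by move=> A mA _; exact: law_prod.
by rewrite ge0_integral_distribution//; exact: measurableT_comp.
Qed.

Lemma independent_expectM :
  expect P (fun x => X x * Y x) = expect P X * expect P Y.
Proof.
apply: EFin_inj; rewrite -expectE ?independent_L1M//.
transitivity (\int[distribution P Z']_z f z)%E.
  rewrite integral_distribution//; first by rewrite unlock.
  exact/Lfun1_integrable/independent_L1M.
rewrite -(@eq_measure_integral _ _ _ setT (distribution P Z') (lX \x lY)%E); last first.
  by move=> A mA _; exact: law_prod.
rewrite -integral12_prod_meas1//.
have E (x : R) : (\int[lY]_y f (x, y) = (expect P Y * x)%:E)%E.
  under eq_integral do rewrite /f /= EFinM.
  by rewrite integralZl// (@integralYE id)// expectE// -EFinM mulrC.
rewrite /fubini_F; under eq_integral do rewrite E EFinM.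
by rewrite integralZl// (@integralXE id)// expectE// -EFinM mulrC.
Qed.

End Independence.

(** * The Ito isometry for finite families of adapted pieces *)

Section MeasurableFor.
Context {d : measure_display} {T : measurableType d} {R : realType}.
Variable G : set (set T).
Hypothesis sG : sigma_algebra [set: T] G.

(** Measurability for a sub-sigma-algebra is ordinary measurability for another
    measurable structure on the same type, which gives access to all the stability
    results on measurable functions. *)
Lemma measurable_forP (X : T -> R) : measurable_for G X <->
  measurable_fun [set: g_sigma_algebraType G] X.
Proof.
have GE : <<s G >> = G by exact: sigma_algebra_id.
split=> [mX _ B mB|mX B mB].
  by rewrite setTI /measurable/= GE; exact: mX.
by have := mX measurableT B mB; rewrite setTI /measurable/= GE.
Qed.

Lemma measurable_forM (X Y : T -> R) : measurable_for G X ->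
  measurable_for G Y -> measurable_for G (fun x => X x * Y x).
Proof.
by move=> /measurable_forP mX /measurable_forP mY;
  apply/measurable_forP; exact: measurable_funM.
Qed.

Lemma measurable_forB (X Y : T -> R) : measurable_for G X ->
  measurable_for G Y -> measurable_for G (fun x => X x - Y x).
Proof.
by move=> /measurable_forP mX /measurable_forP mY;
  apply/measurable_forP; exact: measurable_funB.
Qed.

Lemma measurable_for_cst (c : R) : measurable_for G (fun=> c).
Proof. by apply/measurable_forP; exact: measurable_cst. Qed.

End MeasurableFor.

Section WienerIncrements.
Context {d : measure_display} {Omega : measurableType d} {R : realType}.
Variables (P : probability Omega R) (T : R) (F : R -> set (set Omega)).
Variables (m : nat) (w : 'I_m -> R -> Omega -> R).
Hypotheses (F_filtration : filtration T F) (w_wiener : wiener_process P T F w).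
Variable i : 'I_m.

Local Notation L1 := (Lfun P 1).
Local Notation L2 := (Lfun P 2%:E).

Definition incr (r s : R) (x : Omega) : R := w i s x - w i r x.

Lemma adapted_measurable (s : R) (X : Omega -> R) : 0 <= s <= T ->
  measurable_for (F s) X -> measurable_fun [set: Omega] X.
Proof.
move=> sT mX _ B mB; rewrite setTI.
exact: (filtration_measurable F_filtration sT (mX B mB)).
Qed.

Lemma measurable_for_le (r s : R) (X : Omega -> R) : 0 <= r -> r <= s -> s <= T ->
  measurable_for (F r) X -> measurable_for (F s) X.
Proof.
move=> r0 rs sT mX B mB.
exact: (filtration_nondecreasing F_filtration r0 rs sT (mX B mB)).
Qed.

Lemma incr_measurable_for (r s : R) : 0 <= r -> r <= s -> s <= T ->
  measurable_for (F s) (incr r s).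
Proof.
move=> r0 rs sT; have s0 : 0 <= s by exact: le_trans rs.
apply: measurable_forB.
- by apply: (filtration_sigma_algebra F_filtration); rewrite s0.
- by apply: (wiener_adapted w_wiener); rewrite s0.
- apply: (@measurable_for_le r) => //.
  by apply: (wiener_adapted w_wiener); rewrite r0 (le_trans rs).
Qed.

Lemma incr_measurable (r s : R) : 0 <= r -> r <= s -> s <= T ->
  measurable_fun [set: Omega] (incr r s).
Proof.
move=> r0 rs sT; apply: (@adapted_measurable s); last exact: incr_measurable_for.
by rewrite sT andbT (le_trans r0).
Qed.

Lemma incr_id (r : R) : incr r r = fun=> 0.
Proof. by apply/funext => x; rewrite /incr subrr. Qed.

Let incr_normal (r s : R) : 0 <= r -> r < s -> s <= T ->
  forall B : set R, measurable B ->
  P (incr r s @^-1` B) = normal_prob 0 (Num.sqrt (s - r)) B.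
Proof. by move=> r0 rs sT; exact: (wiener_increment_normal w_wiener). Qed.

Lemma incr_L2 (r s : R) : 0 <= r -> r <= s -> s <= T -> incr r s \in L2.
Proof.
move=> r0 rs sT; have mW := incr_measurable r0 rs sT.
move: rs; rewrite le_eqVlt => /predU1P[rs|rs].
  by rewrite rs incr_id; exact: L2_cst.
apply: (@normal_L2 _ (Num.sqrt (s - r))) => //; last exact: incr_normal.
by rewrite sqrtr_gt0 subr_gt0.
Qed.

Lemma incr_expect (r s : R) : 0 <= r -> r <= s -> s <= T ->
  expect P (incr r s) = 0.
Proof.
move=> r0 rs sT; have mW := incr_measurable r0 rs sT.
move: rs; rewrite le_eqVlt => /predU1P[rs|rs].
  by rewrite rs incr_id; exact: expect_cst.
apply: (@normal_expect _ (Num.sqrt (s - r))) => //; last exact: incr_normal.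
by rewrite sqrtr_gt0 subr_gt0.
Qed.

Lemma incr_expect_sqr (r s : R) : 0 <= r -> r <= s -> s <= T ->
  expect P (fun x => incr r s x ^+ 2) = s - r.
Proof.
move=> r0 rs sT; have mW := incr_measurable r0 rs sT.
move: rs; rewrite le_eqVlt => /predU1P[rs|rs].
  by rewrite rs incr_id subrr expr0n/= expect_cst.
rewrite (@normal_expect_sqr _ (Num.sqrt (s - r))) => //; last exact: incr_normal.
  by rewrite sqr_sqrtr// subr_ge0 ltW.
by rewrite sqrtr_gt0 subr_gt0.
Qed.

(** A function of an increment is independent of the past. *)
Let past_incr (r s : R) (U : Omega -> R) (g : R -> R) :
  0 <= r -> r <= s -> s <= T -> measurable_for (F r) U -> U \in L1 ->
  measurable_fun [set: R] g -> (fun x => g (incr r s x)) \in L1 ->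
  (fun x => U x * g (incr r s x)) \in L1 /\
  expect P (fun x => U x * g (incr r s x)) =
    expect P U * expect P (fun x => g (incr r s x)).
Proof.
move=> r0 rs sT mU U1 mg g1; move: rs; rewrite le_eqVlt => /predU1P[rs|rs].
  rewrite -rs incr_id expect_cst.
  have -> : (fun x => U x * g 0) = (fun x => g 0 * U x).
    by apply/funext => x; rewrite mulrC.
  by split; [exact: L1Z|rewrite expectZ// mulrC].
have rT : r <= T by exact: (le_trans (ltW rs)).
have mU' : measurable_fun [set: Omega] U.
  by apply: (@adapted_measurable r) => //; rewrite r0.
have mgW : measurable_fun [set: Omega] (fun x => g (incr r s x)).
  exact: L1_measurable g1.
have ind A B : measurable A -> measurable B ->
    P (U @^-1` A `&` (fun x => g (incr r s x)) @^-1` B) =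
    (P (U @^-1` A) * P ((fun x => g (incr r s x)) @^-1` B))%E.
  move=> mA mB.
  apply: (wiener_increment_independent w_wiener r0 rs sT); first exact: mU.
  apply: sub_sigma_algebra; exists i => //; exists (g @^-1` B).
    by rewrite -[_ @^-1` _]setTI; exact: mg.
  by rewrite setTI.
by split; [exact: independent_L1M|exact: independent_expectM].
Qed.

Lemma past_incr_mean (r s : R) (U : Omega -> R) :
  0 <= r -> r <= s -> s <= T -> measurable_for (F r) U -> U \in L1 ->
  (fun x => U x * incr r s x) \in L1 /\ expect P (fun x => U x * incr r s x) = 0.
Proof.
move=> r0 rs sT mU U1.
have [|h1 h2] := past_incr r0 rs sT mU U1 (@measurable_id _ _ setT).
  exact/L2_L1/incr_L2.
by split=> //; rewrite h2 incr_expect// mulr0.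
Qed.

Lemma past_incr_sqr (r s : R) (U : Omega -> R) :
  0 <= r -> r <= s -> s <= T -> measurable_for (F r) U -> U \in L1 ->
  (fun x => U x * incr r s x ^+ 2) \in L1 /\
  expect P (fun x => U x * incr r s x ^+ 2) = expect P U * (s - r).
Proof.
move=> r0 rs sT mU U1.
have mg : measurable_fun [set: R] (fun x : R => x ^+ 2).
  by apply: continuous_measurable_fun; exact: sqr_continuous.
have [|h1 h2] := past_incr r0 rs sT mU U1 mg; first exact/L2_sqr/incr_L2.
by split=> //; rewrite h2 incr_expect_sqr.
Qed.

Lemma past_incr_L2 (r s : R) (U : Omega -> R) :
  0 <= r -> r <= s -> s <= T -> measurable_for (F r) U -> U \in L2 ->
  (fun x => U x * incr r s x) \in L2.
Proof.
move=> r0 rs sT mU U2; apply/L2P; split.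
  apply: measurable_funM; first exact: L2_measurable U2.
  exact: (incr_measurable r0 rs sT).
have sF : sigma_algebra [set: Omega] (F r).
  by apply: (filtration_sigma_algebra F_filtration); rewrite r0 (le_trans rs).
have mU2 : measurable_for (F r) (fun x => U x ^+ 2).
  exact: (measurable_forM sF mU mU).
have [] := past_incr_sqr r0 rs sT mU2 (L2_sqr U2).
rewrite (_ : (fun x => U x ^+ 2 * _) = (fun x => (U x * incr r s x) ^+ 2))//.
by apply/funext => x; rewrite exprMn.
Qed.

(** The length of the intersection of [[a, b[] and [[c, e[]. *)
Definition overlap (a b c e : R) : R := Num.max 0 (Num.min b e - Num.max a c).

Section Bilinear.
Variables (a b c e : R) (u v : Omega -> R).
Hypotheses (a0 : 0 <= a) (ab : a <= b) (bT : b <= T).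
Hypotheses (c0 : 0 <= c) (ce : c <= e) (eT : e <= T).
Hypotheses (mu : measurable_for (F a) u) (mv : measurable_for (F c) v).
Hypotheses (u2 : u \in L2) (v2 : v \in L2) (ac : a <= c).

Let U := (fun x => u x * incr a b x).
Let V := (fun x => v x * incr c e x).

Let sF r : 0 <= r <= T -> sigma_algebra [set: Omega] (F r).
Proof. exact: (filtration_sigma_algebra F_filtration). Qed.

Let cT : c <= T. Proof. exact: le_trans eT. Qed.

Let past_incr0 (r s : R) (X Y : Omega -> R) : 0 <= r -> r <= s -> s <= T ->
  measurable_for (F r) X -> measurable_for (F r) Y -> X \in L2 -> Y \in L2 ->
  (fun x => X x * Y x * incr r s x) \in L1 /\
  expect P (fun x => X x * Y x * incr r s x) = 0.
Proof.
move=> r0 rs sT mX mY X2 Y2; apply: past_incr_mean => //; last exact: L2M.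
by apply: measurable_forM => //; apply: sF; rewrite r0 (le_trans rs).
Qed.

(** Both increments are cut at [c] and at [f = min b e]. Every product of two
    increments over disjoint intervals is a variable known at the beginning of the
    later interval times the increment over it, and has expectation [0]. There
    remains the square of the increment over [[c, f[]. *)
Lemma expect_pieces_le :
  expect P (fun x => U x * V x) = expect P (fun x => u x * v x) * overlap a b c e.
Proof.
rewrite /overlap (max_r ac); have [bc|cb] := leP b c.
  rewrite max_l ?mulr0; last first.
    by rewrite subr_le0 ge_min bc.
  rewrite (_ : (fun _ => _) = (fun x => U x * v x * incr c e x)); last first.
    by apply/funext => x; rewrite /V mulrA.
  apply: (past_incr0 c0 ce eT _ mv _ v2).2; last exact: past_incr_L2.
  apply: measurable_forM; first by apply: sF; rewrite c0.
    exact: (@measurable_for_le a).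
  apply: (@measurable_for_le b) => //; first exact: le_trans ab.
  exact: incr_measurable_for.
set f := Num.min b e.
have fb : f <= b by rewrite ge_min lexx.
have fe : f <= e by rewrite ge_min lexx orbT.
have cf : c <= f by rewrite le_min (ltW cb).
have f0 : 0 <= f by exact: le_trans cf.
have fT : f <= T by exact: le_trans bT.
rewrite max_r ?subr_ge0//.
have muc : measurable_for (F c) u by exact: (@measurable_for_le a).
have muv : measurable_for (F c) (fun x => u x * v x).
  by apply: measurable_forM => //; apply: sF; rewrite c0.
have mac : measurable_for (F c) (fun x => u x * incr a c x).
  by apply: measurable_forM => //; [apply: sF; rewrite c0|exact: incr_measurable_for].
have L2c r (X : Omega -> R) : measurable_for (F c) X -> X \in L2 -> c <= r -> r <= T ->
    (fun x => X x * incr c r x) \in L2 /\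
    measurable_for (F r) (fun x => X x * incr c r x).
  move=> mX X2 cr rT; have r0 : 0 <= r by exact: le_trans cr.
  split; first exact: past_incr_L2.
  apply: measurable_forM; first by apply: sF; rewrite r0.
    exact: (@measurable_for_le c).
  exact: incr_measurable_for.
have [h1 e1] := past_incr0 c0 ce eT mac mv (past_incr_L2 a0 ac cT mu u2) v2.
have [h2 e2] := past_incr_sqr c0 cf fT muv (L2M u2 v2).
have [uf2 muf] := L2c f u muc u2 cf fT.
have [vf2 mvf] := L2c f v mv v2 cf fT.
have [h3 e3] := past_incr0 f0 fe eT muf (measurable_for_le c0 cf fT mv) uf2 v2.
have [h4 e4] := past_incr0 f0 fb bT mvf (measurable_for_le c0 cf fT muc) vf2 u2.
(* one of the two increments after [f] vanishes *)
have z x : incr f b x * incr f e x = 0.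
  by rewrite /f /Num.min; case: ifP => _; rewrite incr_id ?mul0r ?mulr0.
rewrite (_ : (fun _ => _) = (fun x => u x * incr a c x * v x * incr c e x +
    (u x * v x * incr c f x ^+ 2 + (u x * incr c f x * v x * incr f e x +
      v x * incr c f x * u x * incr f b x)))).
  rewrite expectD// ?L1D// expectD// ?L1D// expectD//.
  by rewrite e1 e2 e3 e4 add0r !addr0.
apply/funext => x; rewrite /U /V.
have -> : incr a b x = incr a c x + incr c f x + incr f b x by rewrite /incr; ring.
have -> : incr c e x = incr c f x + incr f e x by rewrite /incr; ring.
apply/eqP; rewrite -subr_eq0 -[X in _ == X](mulr0 (u x * v x)) -(z x).
by apply/eqP; ring.
Qed.

End Bilinear.

Lemma overlapC (a b c e : R) : overlap a b c e = overlap c e a b.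
Proof. by rewrite /overlap [Num.min b e]minC [Num.max a c]maxC. Qed.

Lemma expect_pieces (a b c e : R) (u v : Omega -> R) :
  0 <= a -> a <= b -> b <= T -> 0 <= c -> c <= e -> e <= T ->
  measurable_for (F a) u -> measurable_for (F c) v -> u \in L2 -> v \in L2 ->
  expect P (fun x => u x * incr a b x * (v x * incr c e x)) =
  expect P (fun x => u x * v x) * overlap a b c e.
Proof.
move=> a0 ab bT c0 ce eT mu mv u2 v2; have [ac|/ltW ca] := leP a c.
  exact: expect_pieces_le.
rewrite overlapC [X in _ = expect P X * _](_ : _ = (fun x => v x * u x)).
  rewrite -expect_pieces_le//; congr expect; apply/funext => x.
  exact: mulrC.
by apply/funext => x; exact: mulrC.
Qed.

Lemma integral_overlap (t T' a b c e : R) :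
  t <= a -> b <= T' -> t <= c -> e <= T' ->
  (\int[lebesgue_measure]_(s in `[t, T'])
    (\1_(`[a, b[ : set R) s * \1_(`[c, e[ : set R) s)%:E = (overlap a b c e)%:E)%E.
Proof.
move=> ta bT tc eT.
rewrite (eq_integral (fun s : measurableTypeR R => (\1_(`[Num.max a c, Num.min b e[ : set R) s)%:E)); last first.
  move=> s _; rewrite !indicE -natrM mulnb; congr (_%:R%:E); congr nat_of_bool.
  rewrite !mem_setE !in_itv/= ge_max lt_min.
  by case: (a <= s) (c <= s) (s < b) (s < e) => [] [] [] [].
rewrite integral_indic//=.
rewrite (_ : _ `&` _ = `[Num.max a c, Num.min b e[%classic); last first.
  apply/setIidPl => s /=; rewrite !in_itv/= ge_max lt_min.
  move=> /andP[/andP[h1 h2] /andP[h3 h4]].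
  by rewrite (le_trans ta h1) (le_trans (ltW h3)).
rewrite lebesgue_measure_itv/= lte_fin /overlap.
case: ifPn => [h|]; first by rewrite (@max_r _ _ 0) ?EFinB// subr_ge0 ltW.
by rewrite -leNgt => h; rewrite max_l// subr_le0.
Qed.

Section Family.
Variables (K : finType) (a b : K -> R) (u : K -> Omega -> R) (t T' : R).
Hypotheses (t0 : 0 <= t) (T'T : T' <= T).
Hypotheses (ta : forall k, t <= a k) (ab : forall k, a k <= b k).
Hypotheses (bT : forall k, b k <= T').
Hypotheses (mu : forall k, measurable_for (F (a k)) (u k)).
Hypotheses (u2 : forall k, u k \in L2).

Let a0 k : 0 <= a k. Proof. exact: le_trans t0 _. Qed.
Let b0 k : b k <= T. Proof. exact: le_trans (bT k) T'T. Qed.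

(** The pieces may overlap arbitrarily: this makes the isometry directly
    applicable to the difference of two step processes on different partitions,
    without a common refinement. *)
Lemma ito_isometry :
  (\int[lebesgue_measure]_(s in `[t, T'])
    'E_P[fun x => ((\sum_k u k x * \1_(`[a k, b k[ : set R) s) ^+ 2)%R]
   = (expect P (fun x => (\sum_k u k x * incr (a k) (b k) x) ^+ 2))%:E)%E.
Proof.
pose c k l := expect P (fun x => u k x * u l x).
have E s : ('E_P[fun x => ((\sum_k u k x * \1_(`[a k, b k[ : set R) s) ^+ 2)%R] =
    \sum_(k : K) \sum_(l : K) (c k l * (\1_(`[a k, b k[ : set R) s *
      \1_(`[a l, b l[ : set R) s))%:E)%E.
  pose f (k : K) : R := \1_(`[a k, b k[ : set R) s.
  rewrite (_ : (fun x => _ ^+ 2) =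
      (fun x => \sum_k \sum_l f k * f l * (u k x * u l x))); last first.
    apply/funext => x; rewrite expr2 big_distrlr/=.
    by apply: eq_bigr => k _; apply: eq_bigr => l _; ring.
  have f1 k : (fun x => \sum_l f k * f l * (u k x * u l x)) \in L1.
    by apply: L1_sum => l; apply: L1Z; exact: L2M.
  rewrite expectE; last exact: L1_sum.
  rewrite expect_sum -?sumEFin//.
  apply: eq_bigr => k _; rewrite expect_sum; last by move=> l; apply: L1Z; exact: L2M.
  rewrite -sumEFin; apply: eq_bigr => l _; rewrite expectZ ?L2M//.
  by rewrite mulrC.
under eq_integral do rewrite E.
have int1 k l : lebesgue_measure.-integrable (`[t, T'] : set R)
    (fun s : measurableTypeR R => (\1_(`[a k, b k[ : set R) s * \1_(`[a l, b l[ : set R) s)%:E).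
  apply/integrableP; split.
    by apply/measurable_EFinP; apply: measurable_funM; exact: measurable_indic.
  under eq_integral do rewrite gee0_abs ?lee_fin ?mulr_ge0//.
  by rewrite integral_overlap// ltry.
have int2 k l : lebesgue_measure.-integrable (`[t, T'] : set R)
    (fun s : measurableTypeR R => (c k l * (\1_(`[a k, b k[ : set R) s * \1_(`[a l, b l[ : set R) s))%:E).
  have mI : measurable (`[t, T'] : set (measurableTypeR R)) by exact: measurable_itv.
  have := integrableZl mI (c k l) (int1 k l).
  by apply: eq_integrable => // s _; rewrite EFinM.
rewrite integral_sum//; last first.
  by move=> k; apply: integrable_sum => // l.
rewrite (_ : (fun x => _ ^+ 2) = (fun x => \sum_k \sum_l
    (u k x * incr (a k) (b k) x * (u l x * incr (a l) (b l) x)))); last first.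
  by apply/funext => x; rewrite expr2 big_distrlr.
rewrite expect_sum; last first.
  by move=> k; apply: L1_sum => l; apply: L2M; exact: past_incr_L2.
rewrite -sumEFin; apply: eq_bigr => k _; rewrite integral_sum//.
rewrite expect_sum; last by move=> l; apply: L2M; exact: past_incr_L2.
rewrite -sumEFin; apply: eq_bigr => l _.
under eq_integral do rewrite EFinM.
by rewrite integralZl// integral_overlap// expect_pieces.
Qed.

End Family.
End WienerIncrements.

(** * Comparing an Ito integral with one step integral *)

Section ItoApproximation.
Context {d : measure_display} {Omega : measurableType d} {R : realType}.
Variables (P : probability Omega R) (T : R) (F : R -> set (set Omega)).
Variables (m : nat) (w : 'I_m -> R -> Omega -> R).
Hypotheses (F_filtration : filtration T F) (w_wiener : wiener_process P T F w).
Variables (i : 'I_m) (a b : R).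
Hypotheses (a0 : 0 <= a) (bT : b <= T).

Local Notation L1 := (Lfun P 1).
Local Notation L2 := (Lfun P 2%:E).
Implicit Types xi eta : step_process Omega R.

Lemma step_time_bounds xi : step_adapted P F a b xi ->
  forall k, (k <= step_size xi)%N -> a <= step_time xi k <= b.
Proof.
move=> [t0 tn mon _] k kn; apply/andP; split.
  elim: k kn => [|k IH] kn; first by rewrite t0.
  by apply: (le_trans (IH (ltnW kn))); exact: mon.
have [j ->] : exists j, k = (step_size xi - j)%N.
  by exists (step_size xi - k)%N; rewrite subKn.
elim: j => [|j IH]; first by rewrite subn0 tn.
have [jn|nj] := ltnP j (step_size xi); last first.
  have := IH; rewrite (_ : step_size xi - j = 0)%N; last by apply/eqP.
  by rewrite (_ : step_size xi - j.+1 = 0)%N//; apply/eqP; rewrite subn_eq0 leqW.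
apply: le_trans IH; rewrite -(subnSK jn).
by apply: mon; rewrite subnSK// leq_subr.
Qed.

(** The difference of two step processes as one family of pieces. *)
Let family xi eta : step_adapted P F a b xi -> step_adapted P F a b eta ->
  let K := ('I_(step_size xi) + 'I_(step_size eta))%type in
  exists (l r : K -> R) (u : K -> Omega -> R),
  [/\ forall k, a <= l k, forall k, l k <= r k, forall k, r k <= b,
      forall k, measurable_for (F (l k)) (u k) &
      [/\ forall k, u k \in L2,
      forall s x, step_fun xi s x - step_fun eta s x =
        \sum_k u k x * \1_(`[l k, r k[ : set R) s &
      forall x, step_integral (w i) xi x - step_integral (w i) eta x =
        \sum_k u k x * incr w i (l k) (r k) x]].
Proof.
move=> axi aeta K.
pose l (k : K) := match k with inl k => step_time xi k | inr k => step_time eta k end.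
pose r (k : K) := match k with inl k => step_time xi k.+1 | inr k => step_time eta k.+1 end.
pose u (k : K) := match k with inl k => step_val xi k | inr k => fun x => - step_val eta k x end.
have bxi := step_time_bounds axi; have beta := step_time_bounds aeta.
case: axi aeta => _ _ mx vx [_ _ my vy].
exists l, r, u; split.
- by move=> [k|k]; [have /andP[] := bxi _ (ltnW (ltn_ord k))|have /andP[] := beta _ (ltnW (ltn_ord k))].
- by move=> [k|k]; [exact: mx|exact: my].
- by move=> [k|k]; [have /andP[] := bxi _ (ltn_ord k)|have /andP[] := beta _ (ltn_ord k)].
- move=> [k|k]; first exact: (vx _ (ltn_ord k)).1.
  have sF : sigma_algebra [set: Omega] (F (step_time eta k)).
    apply: (filtration_sigma_algebra F_filtration).
    have /andP[h1 h2] := beta _ (ltnW (ltn_ord k)).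
    by rewrite (le_trans a0 h1) (le_trans h2 bT).
  have := measurable_forB sF (measurable_for_cst sF 0) (vy _ (ltn_ord k)).1.
  by congr measurable_for; apply/funext => x; rewrite sub0r.
- split.
  + move=> [k|k]; first exact: (vx _ (ltn_ord k)).2.
    rewrite (_ : u _ = (fun x => -1 * step_val eta k x)).
      by apply: L2Z; exact: (vy _ (ltn_ord k)).2.
    by apply/funext => x; rewrite mulN1r.
  + move=> s x; rewrite big_sumType/= -sumrN; congr (_ + _).
    by apply: eq_bigr => k _; rewrite mulNr.
  + move=> x; rewrite big_sumType/= -sumrN; congr (_ + _).
    by apply: eq_bigr => k _; rewrite mulNr.
Qed.

Lemma step_isometry xi eta :
  step_adapted P F a b xi -> step_adapted P F a b eta ->
  (\int[lebesgue_measure]_(s in `[a, b])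
    'E_P[fun x => ((step_fun xi s x - step_fun eta s x) ^+ 2)%R] =
  (expect P (fun x =>
     (step_integral (w i) xi x - step_integral (w i) eta x) ^+ 2))%:E)%E.
Proof.
move=> axi aeta; have [l [r [u [al lr rb mu [u2 Ef Ei]]]]] := family axi aeta.
rewrite (_ : (fun x => (step_integral _ _ x - _) ^+ 2) =
    (fun x => (\sum_k u k x * incr w i (l k) (r k) x) ^+ 2)); last first.
  by apply/funext => x; rewrite Ei.
rewrite -(ito_isometry F_filtration w_wiener i a0 bT al lr rb mu u2).
apply: eq_integral => s _; congr ('E_P[_])%E.
by apply/funext => x; rewrite Ef.
Qed.

Lemma step_integral_L2 xi : step_adapted P F a b xi ->
  step_integral (w i) xi \in L2.
Proof.
move=> axi; have bxi := step_time_bounds axi; case: axi => _ _ mx vx.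
apply: (@L2_sum _ _ _ P 'I_(step_size xi) _
  (fun k x => step_val xi k x * incr w i (step_time xi k) (step_time xi k.+1) x)) => k.
have [h1 h2] := vx _ (ltn_ord k).
have /andP[h3 h4] := bxi _ (ltnW (ltn_ord k)).
have /andP[h5 h6] := bxi _ (ltn_ord k).
apply: (past_incr_L2 F_filtration w_wiener) => //.
- exact: le_trans h3.
- exact: mx.
- exact: le_trans bT.
Qed.

Lemma step_fun_measurable xi : step_adapted P F a b xi ->
  measurable_fun [set: measurableTypeR R * Omega]
    (fun z : measurableTypeR R * Omega => step_fun xi z.1 z.2).
Proof.
move=> [_ _ _ vx]; apply: measurable_sum => k; apply: measurable_funM.
  apply: (measurableT_comp (L2_measurable (vx _ (ltn_ord k)).2)).
  exact: measurable_snd.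
apply: (measurableT_comp (measurable_indic _) measurable_fst).
exact: measurable_itv.
Qed.

Let mI : measurable (`[a, b] : set (measurableTypeR R)).
Proof. exact: measurable_itv. Qed.

(** The Tonelli theorem, applied on [`[a, b]] times the sample space. *)
Lemma measurable_distance (f g : R -> Omega -> R) :
  measurable_fun (`[a, b] `*` [set: Omega])
    (fun z : measurableTypeR R * Omega => f z.1 z.2) ->
  measurable_fun (`[a, b] `*` [set: Omega])
    (fun z : measurableTypeR R * Omega => g z.1 z.2) ->
  measurable_fun (`[a, b] : set (measurableTypeR R))
    (fun s => 'E_P[fun x => ((f s x - g s x) ^+ 2)%R])%E.
Proof.
move=> mf mg; pose D : set (measurableTypeR R * Omega) := `[a, b] `*` [set: Omega].
have mD : measurable D by exact: measurableX.
pose h := (fun z : measurableTypeR R * Omega => ((f z.1 z.2 - g z.1 z.2) ^+ 2)%:E) \_ D.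
have mh : measurable_fun setT h.
  apply/(measurable_restrictT _ mD)/measurable_EFinP.
  by apply: measurable_funX; exact: measurable_funB.
have h0 z : (0 <= h z)%E.
  by rewrite /h patchE; case: ifP => // _; rewrite lee_fin sqr_ge0.
have := measurable_fun_fubini_tonelli_F (m2 := P) h mh h0.
move=> /(measurable_funTS (D := `[a, b] : set (measurableTypeR R))).
apply: eq_measurable_fun => s sab; rewrite unlock /fubini_F.
apply: eq_integral => x _; rewrite /h patchE ifT// inE; split => //=.
by rewrite inE in sab.
Qed.

Let le_sqr (x y z : R) : (x - y) ^+ 2 <= 2 * (x - z) ^+ 2 + 2 * (y - z) ^+ 2.
Proof.
have := sqr_ge0 ((x - z) + (y - z)); rewrite -subr_ge0 => h.
by rewrite -subr_ge0; apply: le_trans h _; rewrite le_eqVlt; apply/orP; left;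
  apply/eqP; ring.
Qed.

(** The definition of the integral provides some sequence [xi] of step processes.
    By the isometry the integrals of [xi n] and [eta] are eventually about as close
    as [f] and [eta], so that any step process [eta] chosen by hand may be used
    instead of [xi]. *)
Lemma ito_approx (f : R -> Omega -> R) (X : Omega -> R) eta :
  is_ito_integral P F (w i) a b f X -> step_adapted P F a b eta ->
  ((expect P (fun x => (X x - step_integral (w i) eta x) ^+ 2))%:E <=
   4%:E * \int[lebesgue_measure]_(s in `[a, b])
     'E_P[fun x => ((step_fun eta s x - f s x) ^+ 2)%R])%E.
Proof.
move=> [[mf af f2] [xi [axi cxi [_ X2 cX]]]] aeta.
pose D xi0 s := ('E_P[fun x => ((step_fun xi0 s x - f s x) ^+ 2)%R])%E.
have mstep xi0 : step_adapted P F a b xi0 ->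
    measurable_fun (`[a, b] `*` [set: Omega])
      (fun z : measurableTypeR R * Omega => step_fun xi0 z.1 z.2).
  by move=> a1; apply: measurable_funTS; exact: step_fun_measurable.
have mxs xi0 s : step_adapted P F a b xi0 ->
    measurable_fun [set: Omega] (step_fun xi0 s).
  move=> a1; have mpair : measurable_fun [set: Omega]
      (fun x => (s, x) : measurableTypeR R * Omega).
    by apply: measurable_fun_pair; [exact: measurable_cst|exact: measurable_id].
  exact: (measurableT_comp (step_fun_measurable a1) mpair).
have mfs s : a <= s <= b -> measurable_fun [set: Omega] (f s).
  move=> /andP[h1 h2]; apply: (adapted_measurable F_filtration (s := s)).
    by rewrite (le_trans a0 h1) (le_trans h2 bT).
  by apply: af; rewrite h1.
have D0 xi0 s : (0 <= D xi0 s)%E by apply: expectation_ge0 => x; exact: sqr_ge0.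
have mD xi0 : step_adapted P F a b xi0 ->
    measurable_fun (`[a, b] : set (measurableTypeR R)) (D xi0).
  by move=> a1; apply: (measurable_distance (mstep _ a1) mf).
have tri n : ((expect P (fun x => (step_integral (w i) (xi n) x -
      step_integral (w i) eta x) ^+ 2))%:E <=
    2%:E * \int[lebesgue_measure]_(s in `[a, b]) D (xi n) s +
    2%:E * \int[lebesgue_measure]_(s in `[a, b]) D eta s)%E.
  rewrite -step_isometry// -!ge0_integralZl//; [|exact: mD|exact: mD].
  rewrite -ge0_integralD//; last first.
  - by apply: measurable_funeM; exact: mD.
  - by move=> s _; rewrite mule_ge0.
  - by apply: measurable_funeM; exact: mD.
  - by move=> s _; rewrite mule_ge0.
  apply: ge0_le_integral => //.
  - by move=> s _; apply: expectation_ge0 => x; exact: sqr_ge0.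
  - exact: (measurable_distance (mstep _ (axi n)) (mstep _ aeta)).
  - by apply: emeasurable_funD; apply: measurable_funeM; exact: mD.
  move=> s /= sab; rewrite in_itv/= in sab.
  have m2 xi0 : step_adapted P F a b xi0 -> measurable_fun [set: Omega]
      (fun x => ((step_fun xi0 s x - f s x) ^+ 2)%:E).
    move=> a1; apply/measurable_EFinP; apply: measurable_funX.
    by apply: measurable_funB; [exact: mxs|exact: mfs].
  rewrite /D unlock -!ge0_integralZl//; try exact: m2;
    try by move=> x _; rewrite lee_fin sqr_ge0.
  rewrite -ge0_integralD//; try (by apply: measurable_funeM; exact: m2);
    try by move=> x _; rewrite -EFinM lee_fin mulr_ge0// sqr_ge0.
  apply: ge0_le_integral => //.
  - by move=> x _; rewrite lee_fin sqr_ge0.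
  - apply/measurable_EFinP; apply: measurable_funX.
    by apply: measurable_funB; exact: mxs.
  - by apply: emeasurable_funD; apply: measurable_funeM; exact: m2.
  by move=> x _; rewrite -!EFinM -EFinD lee_fin le_sqr.
pose Q := (\int[lebesgue_measure]_(s in `[a, b]) D eta s)%E.
change ((expect P (fun x => (X x - step_integral (w i) eta x) ^+ 2))%:E <= 4%:E * Q)%E.
have Q0 : (0 <= Q)%E by apply: integral_ge0.
have S2 xi0 := step_integral_L2 (xi := xi0).
have bound n : ((expect P (fun x => (X x - step_integral (w i) eta x) ^+ 2))%:E <=
    2%:E * 'E_P[fun x => ((step_integral (w i) (xi n) x - X x) ^+ 2)%R] +
    2%:E * (2%:E * \int[lebesgue_measure]_(s in `[a, b]) D (xi n) s + 2%:E * Q))%E.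
  have h1 : (fun x => (step_integral (w i) (xi n) x - X x) ^+ 2) \in L1.
    by apply/L2_sqr/L2B => //; exact: S2.
  have h2 : (fun x => (step_integral (w i) (xi n) x - step_integral (w i) eta x) ^+ 2) \in L1.
    by apply/L2_sqr/L2B; exact: S2.
  apply: (@le_trans _ _ (2%:E * 'E_P[fun x => ((step_integral (w i) (xi n) x - X x) ^+ 2)%R] +
    2%:E * (expect P (fun x => (step_integral (w i) (xi n) x -
      step_integral (w i) eta x) ^+ 2))%:E)%E); last first.
    by rewrite leeD2l// lee_pmul2l// tri.
  rewrite expectE// -!EFinM -EFinD lee_fin -!expectZ// -expectD ?L1Z//.
  apply: expect_le.
  - by apply/L2_sqr/L2B => //; exact: S2.
  - by apply: L1D; exact: L1Z.
  - move=> x; rewrite -(sqrrN (step_integral _ _ x - X x)) opprB.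
    rewrite -(sqrrN (step_integral _ _ x - step_integral _ _ x)) opprB.
    exact: le_sqr.
have lim : ((2%:E * 'E_P[fun x => ((step_integral (w i) (xi n) x - X x) ^+ 2)%R] +
    2%:E * (2%:E * \int[lebesgue_measure]_(s in `[a, b]) D (xi n) s + 2%:E * Q))%E
    @[n --> \oo] --> (2%:E * 0 + 2%:E * (2%:E * 0 + 2%:E * Q)))%E.
  have [Qoo|Qfin] := eqVneq Q +oo%E.
    rewrite Qoo !mule0 !add0e !gt0_muley ?lte_fin//.
    rewrite (_ : (fun n => _) = (fun=> +oo%E)); first exact: cvg_cst.
    apply/funext => n; rewrite addey ?gt0_muley ?lte_fin// ?addey//.
      by rewrite -ltNye (lt_le_trans _ (mule_ge0 _ (expectation_ge0 _ _)))// => x; exact: sqr_ge0.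
    by rewrite -ltNye (lt_le_trans _ (mule_ge0 _ (integral_ge0 _ _)))// => x.
  have Qf : Q \is a fin_num by rewrite ge0_fin_numE// lt_neqAle Qfin leey.
  apply: cvgeD; first by rewrite mule0 fin_num_adde_defr.
    exact: cvgeZl.
  apply: cvgeZl => //; apply: cvgeD; last exact: cvg_cst.
    by rewrite mule0 fin_num_adde_defr.
  exact: cvgeZl.
suff : ((expect P (fun x => (X x - step_integral (w i) eta x) ^+ 2))%:E <=
    2%:E * 0 + 2%:E * (2%:E * 0 + 2%:E * Q))%E.
  by rewrite !mule0 !add0e muleA -EFinM (_ : 2 * 2 = 4 :> R)//; ring.
apply: (cvge_to_ge lim).
exact: nearW bound.
Qed.

End ItoApproximation.

(** * Legendre polynomials *)

Section Primitive.
Context {R : realType}.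
Implicit Types p q : {poly R}.

Definition prim p : {poly R} :=
  \poly_(i < (size p).+1) (if i is j.+1 then p`_j / j.+1%:R else 0).

Lemma coef_prim p i : (prim p)`_i = if i is j.+1 then p`_j / j.+1%:R else 0.
Proof.
rewrite coef_poly; case: i => [//|j]; rewrite ltnS.
by case: ltnP => // /(nth_default 0) ->; rewrite mul0r.
Qed.

Lemma deriv_prim p : (prim p)^`() = p.
Proof.
apply/polyP => i; by rewrite coef_deriv coef_prim/= -[LHS]mulr_natr divfK.
Qed.

Lemma primD p q : prim (p + q) = prim p + prim q.
Proof.
apply/polyP => -[|i]; rewrite !(coefD, coef_prim) ?addr0//.
by rewrite mulrDl.
Qed.

Lemma primZ c p : prim (c *: p) = c *: prim p.
Proof.
apply/polyP => -[|i]; rewrite !(coefZ, coef_prim) ?mulr0//.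
by rewrite mulrA.
Qed.

Lemma prim_deriv p : prim p^`() = p - (p`_0)%:P.
Proof.
apply/polyP => -[|i]; rewrite !(coefB, coef_prim, coefC)/= ?subrr ?subr0//.
by rewrite coef_deriv -[X in X / _]mulr_natr mulfK// pnatr_eq0.
Qed.

(** The integral over [-1, 1]. *)
Definition pint p : R := (prim p).[1] - (prim p).[-1].

Lemma pintD p q : pint (p + q) = pint p + pint q.
Proof. by rewrite /pint primD !hornerD; ring. Qed.

Lemma pintZ c p : pint (c *: p) = c * pint p.
Proof. by rewrite /pint primZ !hornerZ; ring. Qed.

Lemma pintN p : pint (- p) = - pint p.
Proof. by rewrite -scaleN1r pintZ mulN1r. Qed.

Lemma pintB p q : pint (p - q) = pint p - pint q.
Proof. by rewrite pintD pintN. Qed.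

Lemma pint_deriv p : pint p^`() = p.[1] - p.[-1].
Proof. by rewrite /pint prim_deriv !hornerE; ring. Qed.

Lemma pint_parts p q :
  pint (p^`() * q) = p.[1] * q.[1] - p.[-1] * q.[-1] - pint (p * q^`()).
Proof.
by apply/eqP; rewrite eq_sym subr_eq -pintD -derivM pint_deriv !hornerM.
Qed.

(** The primitive vanishing at [-1]. *)
Definition prim0 p : {poly R} := prim p - ((prim p).[-1])%:P.

Lemma deriv_prim0 p : (prim0 p)^`() = p.
Proof. by rewrite derivB derivC subr0 deriv_prim. Qed.

Lemma prim0N1 p : (prim0 p).[-1] = 0.
Proof. by rewrite !hornerE subrr. Qed.

Lemma prim0_1 p : (prim0 p).[1] = pint p.
Proof. by rewrite !hornerE. Qed.

Lemma pint_prim0C p q : pint q = 0 ->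
  pint (prim0 q * p) = - pint (prim0 p * q).
Proof.
move=> q0; apply/eqP; rewrite -addr_eq0 -{1}(deriv_prim0 p) mulrC pint_parts.
by rewrite !prim0_1 !prim0N1 q0 deriv_prim0 !(mulr0, mul0r) subrr sub0r addNr.
Qed.

End Primitive.

Section Legendre.
Context {R : realType}.
Implicit Types p q : {poly R}.
Local Notation P n := (legendre n : {poly R}).

Lemma derivn_XsubC_exp0 (n j : nat) (c : R) q : (j < n)%N ->
  ((('X - c%:P) ^+ n * q)^`(j)).[c] = 0.
Proof.
elim: j n q => [|j IH] [//|n] q jn.
  by rewrite derivn0 hornerM horner_exp hornerXsubC subrr expr0n/= mul0r.
rewrite derivSn derivM deriv_exp derivXsubC mul1r/= (exprS _ n).
rewrite mulrnAl -mulrnAr -mulrA [X in _ + X]mulrCA -mulrDr.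
by apply: IH.
Qed.

(** Integration by parts, [k] times. *)
Lemma pint_derivn V q k :
  (forall j, (j < k)%N -> V^`(j).[1] = 0 /\ V^`(j).[-1] = 0) ->
  pint (V^`(k) * q) = (-1) ^+ k * pint (V * q^`(k)).
Proof.
elim: k q => [|k IH] q V0; first by rewrite !derivn0 expr0 mul1r.
rewrite derivnS pint_parts; have [-> ->] := V0 k (ltnSn k).
rewrite !mul0r subrr sub0r IH => [|j jk]; last by apply: V0; exact: ltnW.
by rewrite -derivSn exprS mulN1r mulNr.
Qed.

Let sqr_sub1E : 'X^2 - 1 = ('X - 1%:P) * ('X - (-1)%:P) :> {poly R}.
Proof. by rewrite polyCN polyC1 opprK -subr_sqr expr1n. Qed.

Let U n : {poly R} := ('X^2 - 1) ^+ n.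

(** In Rodrigues' formula the [n] derivatives are moved to [q], which they kill;
    the boundary terms vanish since [-1] and [1] are roots of order [n]. *)
Lemma legendre_orthogonal n q : (size q <= n)%N -> pint (P n * q) = 0.
Proof.
move=> qn; rewrite /legendre -scalerAl pintZ pint_derivn.
  by rewrite (derivn_poly0 qn) mulr0 /pint -(scale0r 0) primZ !hornerZ !mul0r
    subrr !mulr0.
move=> j jn; rewrite sqr_sub1E exprMn; split; first exact: derivn_XsubC_exp0.
by rewrite mulrC; exact: derivn_XsubC_exp0.
Qed.

Lemma legendreN1 n : (P n).[-1] = (-1) ^+ n.
Proof.
have -> : P n = (2 ^ n * n`!)%:R^-1 *:
    (('X - (-1)%:P) ^+ n * ('X - 1%:P) ^+ n)^`(n).
  by rewrite /legendre sqr_sub1E exprMn [X in X^`(n)]mulrC.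
rewrite hornerZ derivn_XsubC_exp horner_exp hornerXsubC.
rewrite (_ : -1 - 1 = -1 * 2 :> R); last by ring.
rewrite exprMn natrM natrX; field.
by rewrite pnatr_eq0 -lt0n fact_gt0 expf_neq0.
Qed.

Let size_U n : size (U n) = (2 * n).+1.
Proof.
have := size_exp ('X^2 - 1 : {poly R}) n.
rewrite -polyC1 size_XnsubC//= => <-; rewrite prednK//.
by rewrite lt0n size_poly_eq0 expf_neq0// -size_poly_eq0 size_XnsubC.
Qed.

Let coef_U n : (U n)`_(2 * n) = 1.
Proof.
have /monicP : U n \is monic by rewrite monic_exp// -polyC1 monicXnsubC.
by rewrite lead_coefE size_U.
Qed.

(** The leading coefficient of [legendre n], see [legendre_coef_lead]. *)
Definition legendre_lead n : R := ((2 ^ n * n`!)%:R)^-1 * ((n + n) ^_ n)%:R.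

(** Coefficients above the degree vanish; the form of a conditional makes this a
    rewriting rule. *)
Lemma legendre_coef n i : (P n)`_i =
  if (i <= n)%N then (P n)`_i else 0.
Proof.
case: leqP => // ni; rewrite /legendre coefZ coef_derivn nth_default ?mul0rn ?mulr0//.
by rewrite size_U mul2n -addnn ltn_add2l.
Qed.

Lemma legendre_coef_lead n : (P n)`_n = legendre_lead n.
Proof.
have := coef_U n; rewrite mul2n -addnn => E.
by rewrite /legendre coefZ coef_derivn -/(U n) E.
Qed.

Lemma legendre_leadS n :
  legendre_lead n.+1 = (2 * n + 1)%:R / n.+1%:R * legendre_lead n.
Proof.
have E k : legendre_lead k = (k + k)`!%:R / (2 ^ k * k`! * k`!)%:R.
  rewrite /legendre_lead -(@ffact_fact (k + k) k) ?leq_addr// addnK !natrM.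
  by field; rewrite !pnatr_eq0 -!lt0n fact_gt0 expn_gt0.
rewrite !E addnS addSn !factS expnS !natrM.
have h1 : n.+1%:R != 0 :> R by rewrite pnatr_eq0.
have h2 : n`!%:R != 0 :> R by rewrite pnatr_eq0 -lt0n fact_gt0.
have h3 : (2 ^ n)%:R != 0 :> R by rewrite pnatr_eq0 -lt0n expn_gt0.
have -> : (n + n).+2%:R = 2 * n.+1%:R :> R by rewrite -natrM; congr _%:R; lia.
have -> : (n + n).+1%:R = (2 * n + 1)%:R :> R by congr _%:R; lia.
move: (n.+1%:R : R) h1 (n`!%:R : R) h2 ((2 ^ n)%:R : R) h3 ((n + n)`!%:R : R) ((2 * n + 1)%:R : R).
by move=> x x0 y y0 z z0 u v; field; rewrite x0 y0 z0.
Qed.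

(** The integral of [('X * P n ^+ 2)^`()] is [P n (1)^2 + P n (-1)^2 = 2]. It is
    also [(2 n + 1)] times the squared norm, because ['X * (P n)^`()] equals
    [n *: P n] up to terms of lower degree, which are orthogonal to [P n]. *)
Lemma legendre_norm n : pint (P n * P n) = 2 / (2 * n + 1)%:R.
Proof.
set N := pint _; pose q := 'X * (P n)^`() - n%:R *: P n.
have qn : (size q <= n)%N.
  apply/leq_sizeP => i ni; rewrite coefB coefXM coefZ coef_deriv.
  case: i ni => [|i] ni; first by move: ni; rewrite leqn0 => /eqP ->; rewrite mul0r subrr.
  rewrite /= -[X in X - _]mulr_natl; move: ni; rewrite leq_eqVlt => /predU1P[->|ni].
    by rewrite subrr.
  by rewrite [_`_i.+1]legendre_coef leqNgt ni !mulr0 subrr.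
have h1 : pint (P n * ('X * (P n)^`())) = n%:R * N.
  apply/eqP; rewrite -subr_eq0 -pintZ -pintB scalerAr -mulrBr.
  by rewrite legendre_orthogonal.
have h2 : pint ('X * (P n * P n))^`() = 2.
  rewrite pint_deriv !hornerM hornerX legendre1 legendreN1 hornerX.
  have -> : (-1) ^+ n * (-1) ^+ n = 1 :> R by rewrite -expr2 sqrr_sign.
  by ring.
have h3 : ('X * (P n * P n))^`() = P n * P n + 2 *: (P n * ('X * (P n)^`())).
  by rewrite !derivM derivX scaler_nat; ring.
move: h2; rewrite h3 pintD pintZ h1 -/N => h2.
have n0 : (2 * n + 1)%:R != 0 :> R by rewrite pnatr_eq0 addn1.
apply: (mulIf n0); rewrite divfK// -h2 natrD natrM; ring.
Qed.

Lemma legendre_orthonormal i j :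
  pint (P i * P j) = if i == j then 2 / (2 * i + 1)%:R else 0.
Proof.
have size_P k : (size (P k) <= k.+1)%N.
  by apply/leq_sizeP => l kl; rewrite legendre_coef leqNgt kl.
case: eqP => [<-|/eqP]; first exact: legendre_norm.
rewrite neq_ltn => /orP[ij|ji].
  by rewrite mulrC legendre_orthogonal// (leq_trans (size_P _)).
by rewrite legendre_orthogonal// (leq_trans (size_P _)).
Qed.

(** Modulo lower degree, the primitive of [P n] is a multiple of [P n.+1], the
    ratio being read off the leading coefficients. *)
Lemma legendre_prim0 n :
  pint (prim0 (P n) * P n.+1) = 2 / ((2 * n + 1) * (2 * n + 3))%:R.
Proof.
pose r : R := ((2 * n + 1)%:R)^-1.
have n1 : (2 * n + 1)%:R != 0 :> R by rewrite pnatr_eq0 addn1.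
have n3 : (2 * n + 3)%:R != 0 :> R by rewrite pnatr_eq0 addn3.
have qn : (size (prim0 (P n) - r *: P n.+1)%R <= n.+1)%N.
  apply/leq_sizeP => -[//|i] ni.
  rewrite !coefB coef_prim coefC [(polyseq (r *: _))`_ _]coefZ subr0 /=.
  move: ni; rewrite ltnS leq_eqVlt => /predU1P[<-|ni].
    rewrite !legendre_coef_lead legendre_leadS /r.
    have n2 : n.+1%:R != 0 :> R by rewrite pnatr_eq0.
    move: (legendre_lead n) (n.+1%:R : R) n2 ((2 * n + 1)%:R : R) n1.
    by move=> x y y0 z z0; field; rewrite y0 z0.
  rewrite legendre_coef leqNgt ni mul0r [_`_i.+1]legendre_coef leqNgt ltnS ni.
  by rewrite mulr0 subrr.
have -> : prim0 (P n) * P n.+1 =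
    P n.+1 * (prim0 (P n) - r *: P n.+1) + r *: (P n.+1 * P n.+1).
  by rewrite (mulrBr (P n.+1) (prim0 _)) scalerAr subrK mulrC.
rewrite pintD pintZ legendre_orthogonal// legendre_norm add0r /r natrM.
rewrite (_ : 2 * n.+1 + 1 = 2 * n + 3)%N; last by lia.
by move: ((2 * n + 1)%:R : R) n1 ((2 * n + 3)%:R : R) n3 => x x0 y y0; field; rewrite x0 y0.
Qed.

(** The telescoping sum [sum 1 / (4 j^2 - 1)], with [j = i + 1]. *)
Lemma sum_legendre_defect n :
  \sum_(0 <= i < n) 8 / ((2 * i + 1) * (2 * i + 3))%:R =
  4 - 4 / (2 * n + 1)%:R :> R.
Proof.
elim: n => [|n IH]; first by rewrite big_geq// mulr1n divr1 subrr.
rewrite big_nat_recr//= IH (_ : 2 * n.+1 + 1 = 2 * n + 3)%N; last by lia.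
rewrite natrM; have n1 : (2 * n + 1)%:R != 0 :> R by rewrite pnatr_eq0 addn1.
have n3 : (2 * n + 3)%:R != 0 :> R by rewrite pnatr_eq0 addn3.
have E : (2 * n + 3)%:R = (2 * n + 1)%:R + 2 :> R by rewrite -natrD -addnA.
rewrite E in n3 *; move: ((2 * n + 1)%:R : R) n1 n3 => x x0 y0.
by field; rewrite x0 y0.
Qed.

End Legendre.

(** * Riemann sums of the kernel *)

Section RiemannSums.
Context {R : realType}.
Implicit Types p q : {poly R}.

Lemma poly_bounded p : exists2 M : R, 0 <= M &
  forall x, -1 <= x <= 1 -> `|p.[x]| <= M.
Proof.
elim/poly_ind: p => [|p c [M M0 HM]].
  by exists 0 => // x _; rewrite horner0 normr0.
exists (M + `|c|); first by rewrite addr_ge0.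
move=> x x1; rewrite hornerMXaddC (le_trans (ler_normD _ _))// lerD2r normrM.
by rewrite -[leRHS]mulr1 ler_pM// ?HM// ler_norml.
Qed.

Lemma poly_taylor1 p : exists2 C : R, 0 <= C & forall x y,
  -1 <= x <= 1 -> -1 <= y <= 1 ->
  `|p.[y] - p.[x] - (y - x) * p^`().[x]| <= C * (y - x) ^+ 2.
Proof.
elim/poly_ind: p => [|p c [C C0 HC]].
  by exists 0 => // x y _ _; rewrite deriv0 !horner0 mulr0 !subr0 normr0 mul0r.
have [M M0 HM] := poly_bounded p^`().
exists (C + M); first by rewrite addr_ge0.
move=> x y x1 y1.
have -> : (p * 'X + c%:P).[y] - (p * 'X + c%:P).[x] -
    (y - x) * (p * 'X + c%:P)^`().[x] =
    y * (p.[y] - p.[x] - (y - x) * p^`().[x]) + p^`().[x] * (y - x) ^+ 2.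
  rewrite derivD derivM derivX derivC mulr1 addr0 !hornerD.
  by rewrite !hornerM !hornerX !hornerC; ring.
rewrite (le_trans (ler_normD _ _))// [leRHS]mulrDl lerD//; last first.
  by rewrite normrM normrX real_normK ?num_real// ler_wpM2r ?sqr_ge0// HM.
rewrite normrM -[leRHS]mul1r ler_pM// ?HC// ler_norml.
exact: y1.
Qed.

Section Grid.
Variable N : nat.
Let h : R := 2 / N.+1%:R.

(** The [N.+1] intervals of the grid have length [2 / N.+1]; the sums below use
    their left endpoints [node 0, ..., node N]. *)
Definition node (k : nat) : R := 2 * k%:R / N.+1%:R - 1.

Lemma node_itv k : (k <= N.+1)%N -> -1 <= node k <= 1.
Proof.
move=> kN; rewrite /node; have : k%:R <= N.+1%:R :> R by rewrite ler_nat.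
have N0 : 0 < N.+1%:R :> R by [].
move=> kN'; rewrite lerDr !lerBlDr mulr_ge0 ?invr_ge0 ?mulr_ge0//=.
by rewrite ler_pdivrMr//; lra.
Qed.

Lemma node0 : node 0 = -1. Proof. by rewrite /node mulr0 mul0r sub0r. Qed.

Lemma nodeS k : node k.+1 - node k = h.
Proof.
have : N.+1%:R != 0 :> R by rewrite pnatr_eq0.
by rewrite /node /h -(natr1 k); move: (N.+1%:R : R) => x x0; field.
Qed.

Definition psum p k : R := h * \sum_(0 <= l < k) p.[node l].

(** Partial Riemann sums of [p] follow its primitive with an error of the order
    of the mesh, uniformly in the upper bound. *)
Lemma psum_prim0 p C :
  (forall x y, -1 <= x <= 1 -> -1 <= y <= 1 ->
     `|(prim0 p).[y] - (prim0 p).[x] - (y - x) * (prim0 p)^`().[x]| <=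
     C * (y - x) ^+ 2) ->
  forall k, (k <= N.+1)%N -> `|psum p k - (prim0 p).[node k]| <= 2 * C * h.
Proof.
move=> HC k kN; have h0 : 0 < h by rewrite divr_gt0.
have C0 : 0 <= C.
  have i1 : -1 <= (-1 : R) <= 1 by apply/andP; split; lra.
  have i2 : -1 <= (1 : R) <= 1 by apply/andP; split; lra.
  have e : 0 < (1 - -1 : R) ^+ 2 by rewrite exprn_gt0// opprK.
  by have := le_trans (normr_ge0 _) (HC _ _ i1 i2); rewrite (pmulr_lge0 _ e).
apply: (@le_trans _ _ (C * h ^+ 2 * k%:R)); last first.
  have : h * k%:R <= 2.
    by rewrite /h mulrAC ler_pdivrMr// ler_pM2l// ler_nat.
  move=> hk; rewrite (_ : C * _ * _ = C * h * (h * k%:R)); last by ring.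
  rewrite [leRHS](_ : _ = C * h * 2); last by ring.
  by rewrite ler_wpM2l// mulr_ge0// ltW.
elim: k kN => [|k IH] kN.
  by rewrite /psum big_geq// mulr0 node0 prim0N1 subrr normr0 mulr0.
have kN' := ltnW kN.
rewrite /psum big_nat_recr//= mulrDr -/(psum p k).
have := HC (node k) (node k.+1) (node_itv kN') (node_itv kN).
rewrite nodeS deriv_prim0 => H.
rewrite (_ : _ - _ = psum p k - (prim0 p).[node k] -
  ((prim0 p).[node k.+1] - (prim0 p).[node k] - h * p.[node k])); last by ring.
rewrite (le_trans (ler_normB _ _))// -natr1 mulrDr mulr1 lerD// IH//.
Qed.

End Grid.

Let h (N : nat) : R := 2 / N.+1%:R.

Let h0 : h @ \oo --> (0 : R).
Proof.
rewrite -[X in _ --> X](mulr0 (2 : R)); apply: cvgM; first exact: cvg_cst.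
exact: cvg_harmonic.
Qed.

Let cvg_err (f g : nat -> R) (l C : R) : (forall N, `|g N - f N| <= C * h N) ->
  f @ \oo --> l -> g @ \oo --> l.
Proof.
move=> H fl; have e0 : (fun N => g N - f N) @ \oo --> (0 : R).
  apply/norm_cvg0P; apply: (@squeeze_cvgr _ _ _ _ (fun=> 0) (fun N => C * h N)).
  - by apply: nearW => N; rewrite normr_ge0 H.
  - exact: cvg_cst.
  - rewrite -[X in _ --> X](mulr0 C); apply: cvgM; first exact: cvg_cst.
    exact: h0.
rewrite (_ : g = (fun N => (g N - f N) + f N)); last first.
  by apply/funext => N; rewrite subrK.
by rewrite -[l]add0r; apply: cvgD.
Qed.

Let cvg_sum_nat (f : nat -> nat -> R) (l : nat -> R) n :
  (forall j, f j N @[N --> \oo] --> l j) ->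
  \sum_(0 <= j < n) f j N @[N --> \oo] --> \sum_(0 <= j < n) l j.
Proof.
move=> fl; elim: n => [|n IH].
  rewrite big_geq// (_ : (fun N => _) = fun=> 0); first exact: cvg_cst.
  by apply/funext => N; rewrite big_geq.
rewrite big_nat_recr//=.
rewrite (_ : (fun N => _) = (fun N => \sum_(0 <= j < n) f j N + f n N)).
  by apply: cvgD; [exact: IH|exact: fl].
by apply/funext => N; rewrite big_nat_recr.
Qed.

Lemma nodeN N : node N N.+1 = 1.
Proof. by rewrite /node mulfK ?pnatr_eq0//; ring. Qed.

Lemma psum_cvg p : psum N p N.+1 @[N --> \oo] --> pint p.
Proof.
have [C C0 HC] := poly_taylor1 (prim0 p).
apply: (@cvg_err (fun=> pint p) _ _ (2 * C)); last exact: cvg_cst.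
by move=> N; have := psum_prim0 HC (leqnn N.+1); rewrite nodeN prim0_1.
Qed.

Lemma psum_mul_cvg p q :
  h N * (\sum_(0 <= k < N.+1) psum N p k * q.[node N k]) @[N --> \oo] -->
  pint (prim0 p * q).
Proof.
have [C C0 HC] := poly_taylor1 (prim0 p).
have [M M0 HM] := poly_bounded q.
apply: (@cvg_err (fun N => psum N (prim0 p * q) N.+1) _ _ (4 * C * M)) => [N|];
  last exact: psum_cvg.
have hN : 0 < h N by rewrite divr_gt0.
rewrite /psum -mulrBr -sumrB normrM (gtr0_norm hN).
rewrite [leRHS]mulrC ler_pM2l//; apply: le_trans (ler_norm_sum _ _ _) _.
apply: (@le_trans _ _ (\sum_(0 <= k < N.+1) 2 * C * h N * M)).
  rewrite big_nat [leRHS]big_nat; apply: ler_sum => k /andP[_ kN].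
  rewrite hornerM -mulrBl normrM ler_pM//.
    by apply: psum_prim0 => //; exact: ltnW.
  by apply: HM; apply: node_itv; exact: ltnW.
rewrite sumr_const_nat subn0 -[leLHS]mulr_natr /h le_eqVlt; apply/orP; left.
have : N.+1%:R != 0 :> R by rewrite pnatr_eq0.
by move: (N.+1%:R : R) => x x0; apply/eqP; field.
Qed.

(** Double Riemann sums over the square [-1, 1]^2. *)
Definition dsum N (f : nat -> nat -> R) : R :=
  h N ^+ 2 * \sum_(l < N.+1) \sum_(k < N.+1) f l k.

Lemma dsumD N f g : dsum N (fun l k => f l k + g l k) = dsum N f + dsum N g.
Proof.
rewrite /dsum -mulrDr -big_split/=; congr (_ * _).
by apply: eq_bigr => l _; rewrite big_split.
Qed.

Lemma dsumZ N c f : dsum N (fun l k => c * f l k) = c * dsum N f.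
Proof.
rewrite /dsum mulrCA; congr (_ * _); rewrite mulr_sumr.
by apply: eq_bigr => l _; rewrite mulr_sumr.
Qed.

Lemma dsumB N f g : dsum N (fun l k => f l k - g l k) = dsum N f - dsum N g.
Proof.
rewrite -mulN1r -dsumZ -dsumD; congr dsum.
by apply/funext => l; apply/funext => k; rewrite mulN1r.
Qed.

Lemma dsum_sum N n (F : nat -> nat -> nat -> R) :
  dsum N (fun l k => \sum_(0 <= j < n) F j l k) = \sum_(0 <= j < n) dsum N (F j).
Proof.
elim: n => [|n IH].
  rewrite big_geq//; transitivity (dsum N (fun l k => 0 * 0)).
    by congr dsum; apply/funext => l; apply/funext => k; rewrite big_geq// mul0r.
  by rewrite dsumZ mul0r.
rewrite big_nat_recr//= -IH -dsumD; congr dsum.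
by apply/funext => l; apply/funext => k; rewrite big_nat_recr.
Qed.

Lemma dsumC N f : dsum N (fun l k => f k l) = dsum N f.
Proof. by rewrite /dsum exchange_big. Qed.

Lemma dsum_prod N p q :
  dsum N (fun l k => p.[node N l] * q.[node N k]) = psum N p N.+1 * psum N q N.+1.
Proof.
rewrite /dsum /psum !big_mkord mulrACA -expr2; congr (_ * _).
by rewrite big_distrl/=; apply: eq_bigr => l _; rewrite mulr_sumr.
Qed.

Definition sg (l k : nat) : R := (l < k)%N%:R - (k < l)%N%:R.

Lemma dsum_lt N p q :
  dsum N (fun l k => (l < k)%N%:R * (p.[node N l] * q.[node N k])) =
  h N * \sum_(0 <= k < N.+1) psum N p k * q.[node N k].
Proof.
rewrite /dsum exchange_big/= expr2 -mulrA; congr (_ * _).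
rewrite big_mkord mulr_sumr; apply: eq_bigr => k _.
rewrite /psum -mulrA; congr (_ * _); rewrite mulr_suml.
rewrite (@big_nat_widen _ _ _ 0 k N.+1)/=; last by rewrite ltnW.
rewrite big_mkord [RHS]big_mkcond/=; apply: eq_bigr => l _.
by case: ifP => _; rewrite ?mul1r ?mul0r.
Qed.

(** Exchanging [l] and [k] changes the sign of both factors. *)
Lemma dsum_sg p q N :
  dsum N (fun l k => sg l k * (p.[node N l] * q.[node N k] -
                               q.[node N l] * p.[node N k])) =
  2 * (h N * (\sum_(0 <= k < N.+1) psum N p k * q.[node N k]) -
       h N * (\sum_(0 <= k < N.+1) psum N q k * p.[node N k])).
Proof.
rewrite -!dsum_lt.
pose f l k : R := (l < k)%N%:R * (p.[node N l] * q.[node N k]).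
pose g l k : R := (l < k)%N%:R * (q.[node N l] * p.[node N k]).
transitivity (dsum N (fun l k => (f l k - g l k) + (f k l - g k l))).
  by congr dsum; apply/funext => l; apply/funext => k; rewrite /f /g /sg; ring.
by rewrite dsumD !dsumB (dsumC N f) (dsumC N g) -/f -/g; ring.
Qed.

Lemma dsum_sg2 N : dsum N (fun l k => sg l k ^+ 2) = 4 - 2 * h N.
Proof.
have E (l : 'I_N.+1) : \sum_(k < N.+1) sg l k ^+ 2 = N%:R.
  rewrite (bigD1 l)//= /sg ltnn subrr expr0n/= add0r.
  rewrite (eq_bigr (fun=> 1)).
    by rewrite sumr_const cardC1 card_ord.
  by move=> k kl; case: ltngtP => [||/val_inj kl'];
    rewrite ?(subr0, sub0r, sqrrN, expr1n)//; move: kl; rewrite kl' eqxx.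
rewrite /dsum (eq_bigr _ (fun l _ => E l)) sumr_const card_ord -[X in _ * X]mulr_natr /h.
have : N%:R = N.+1%:R - 1 :> R by rewrite -natr1 addrK.
have : N.+1%:R != 0 :> R by rewrite pnatr_eq0.
by move: (N.+1%:R : R) => x x0 ->; field.
Qed.

Section LegendreKernel.
Local Notation P n := (legendre n : {poly R}).

(** Twice the kernel of the discretised truncation error: the sign function
    comes from the area itself, the sum from the first [n] terms of the series. *)
Definition levy_kernel N n (l k : nat) : R := sg l k -
  \sum_(0 <= j < n) ((P j).[node N l] * (P j.+1).[node N k] -
                     (P j.+1).[node N l] * (P j).[node N k]).

Let psi N j l k : R := (P j).[node N l] * (P j.+1).[node N k] -
                     (P j.+1).[node N l] * (P j).[node N k].

Let c j : R := 8 / ((2 * j + 1) * (2 * j + 3))%:R.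

Let sg_psi j : dsum N (fun l k => sg l k * psi N j l k) @[N --> \oo] --> c j.
Proof.
rewrite [X in _ --> X](_ : c j = 2 * (pint (prim0 (P j) * P j.+1) -
    pint (prim0 (P j.+1) * P j))).
  rewrite (_ : (fun N => _) = (fun N => 2 * (h N * (\sum_(0 <= k < N.+1) psum N (P j) k * (P j.+1).[node N k]) -
       h N * (\sum_(0 <= k < N.+1) psum N (P j.+1) k * (P j).[node N k])))).
    apply: cvgM; first exact: cvg_cst.
    by apply: cvgB; exact: psum_mul_cvg.
  by apply/funext => N; rewrite -dsum_sg.
have P0 : pint (P j.+1) = 0.
  by have := @legendre_orthogonal R j.+1 1; rewrite mulr1 size_poly1 => ->.
rewrite [pint (prim0 (P j.+1) * _)]pint_prim0C//.
rewrite legendre_prim0 /c opprK.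
by move: (((2 * j + 1) * (2 * j + 3))%:R^-1 : R) => y; ring.
Qed.

Let psi_psi i j : dsum N (fun l k => psi N i l k * psi N j l k) @[N --> \oo] -->
  (if i == j then c j else 0).
Proof.
pose S N p := psum N p N.+1.
rewrite (_ : (fun N => _) = (fun N =>
  (S N (P i * P j) * S N (P i.+1 * P j.+1) -
   S N (P i * P j.+1) * S N (P i.+1 * P j)) -
  (S N (P i.+1 * P j) * S N (P i * P j.+1) -
   S N (P i.+1 * P j.+1) * S N (P i * P j)))); last first.
  apply/funext => N; rewrite -!dsum_prod -!dsumB; congr dsum.
  by apply/funext => l; apply/funext => k; rewrite /psi !hornerM; ring.
have cS p : S N p @[N --> \oo] --> pint p by exact: psum_cvg.
rewrite [X in _ --> X](_ : _ =
  (pint (P i * P j) * pint (P i.+1 * P j.+1) -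
   pint (P i * P j.+1) * pint (P i.+1 * P j)) -
  (pint (P i.+1 * P j) * pint (P i * P j.+1) -
   pint (P i.+1 * P j.+1) * pint (P i * P j))).
  by apply: cvgB; apply: cvgB; apply: cvgM; exact: cS.
rewrite !legendre_orthonormal eqSS; case: (eqVneq i j) => [->|ij].
  rewrite ltn_eqF// gtn_eqF// /c natrM (_ : 2 * j.+1 + 1 = 2 * j + 3)%N; last by lia.
  have n1 : (2 * j + 1)%:R != 0 :> R by rewrite pnatr_eq0 addn1.
  have n3 : (2 * j + 3)%:R != 0 :> R by rewrite pnatr_eq0 addn3.
  by move: ((2 * j + 1)%:R : R) n1 ((2 * j + 3)%:R : R) n3 => x x0 y y0; field; rewrite x0 y0.
case: eqVneq => [->|_]; last by rewrite !mul0r !mulr0 !subr0.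
have -> : (j.+2 == j) = false by apply/negbTE; rewrite neq_ltn; lia.
by move: (2 / _) => z; ring.
Qed.

(** Bessel's identity, asymptotically: the square norm of [sg] tends to [4], the
    functions [psi _ j] become orthogonal, and both the square norm of [psi _ j] and
    its scalar product with [sg] tend to [c j]. Hence the limit is
    [4 - sum_(j < n) c j]. *)
Lemma levy_kernel_cvg n :
  dsum N (fun l k => levy_kernel N n l k ^+ 2) @[N --> \oo] -->
  (4 / (2 * n + 1)%:R : R).
Proof.
rewrite (_ : (fun N => _) = (fun N => 4 - 2 * h N -
    2 * \sum_(0 <= j < n) dsum N (fun l k => sg l k * psi N j l k) +
    \sum_(0 <= i < n) \sum_(0 <= j < n) dsum N (fun l k => psi N i l k * psi N j l k))).
  rewrite [X in _ --> X](_ : _ = 4 - 2 * 0 - 2 * (\sum_(0 <= j < n) c j) +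
      \sum_(0 <= i < n) \sum_(0 <= j < n) (if i == j then c j else 0)).
    apply: cvgD; last first.
      by apply: cvg_sum_nat => i; apply: cvg_sum_nat => j; exact: psi_psi.
    apply: cvgB.
      by apply: cvgB; [exact: cvg_cst|apply: cvgM; [exact: cvg_cst|exact: h0]].
    apply: cvgM; first exact: cvg_cst.
    by apply: cvg_sum_nat => j; exact: sg_psi.
  rewrite [X in _ + X](_ : _ = \sum_(0 <= j < n) c j).
    rewrite sum_legendre_defect; have : (2 * n + 1)%:R != 0 :> R by rewrite pnatr_eq0 addn1.
    by move: ((2 * n + 1)%:R : R) => x x0; field.
  rewrite !big_mkord; apply: eq_bigr => i _; rewrite big_mkord.
  rewrite (bigD1 i)//= eqxx big1 ?addr0// => j ji.
  by rewrite -[_ == _ :> nat]/(i == j) eq_sym (negPf ji).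
apply/funext => N; rewrite -dsum_sg2 -!dsum_sum.
have -> : \sum_(0 <= i < n) \sum_(0 <= j < n) dsum N (fun l k => psi N i l k * psi N j l k) =
  dsum N (fun l k => \sum_(0 <= i < n) \sum_(0 <= j < n) psi N i l k * psi N j l k).
  by rewrite dsum_sum; apply: eq_bigr => i _; rewrite dsum_sum.
rewrite -dsumZ -dsumB -dsumD; congr dsum; apply/funext => l; apply/funext => k.
rewrite /levy_kernel -/(psi N _ l k) sqrrB; congr (_ - _ + _).
  by rewrite mulr_sumr -mulr_natl.
by rewrite expr2 big_distrlr.
Qed.

End LegendreKernel.
End RiemannSums.

(** * Approximation along uniform grids *)

Section Grid.
Context {R : realType}.
Variables (a b : R).
Hypothesis ab : a <= b.

Definition grid (N k : nat) : R := a + k%:R * ((b - a) / N.+1%:R).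

Lemma grid0 N : grid N 0 = a. Proof. by rewrite /grid mul0r addr0. Qed.

Lemma gridN N : grid N N.+1 = b.
Proof. by rewrite /grid mulrCA divff ?pnatr_eq0// mulr1 addrC subrK. Qed.

Lemma gridS N k : grid N k.+1 - grid N k = (b - a) / N.+1%:R.
Proof. by rewrite /grid -natr1; ring. Qed.

Lemma grid_mono N k l : (k <= l)%N -> grid N k <= grid N l.
Proof. by move=> kl; rewrite lerD2l ler_wpM2r ?divr_ge0 ?subr_ge0// ler_nat. Qed.

Lemma grid_itv N k : (k <= N.+1)%N -> a <= grid N k <= b.
Proof.
move=> kN; have := grid_mono N kN; have := grid_mono N (leq0n k).
by rewrite grid0 gridN => -> ->.
Qed.

Lemma grid_locate N s : a <= s < b ->
  exists2 k, (k < N.+1)%N & grid N k <= s < grid N k.+1.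
Proof.
move=> /andP[as_ sb]; have ba : 0 < b - a by rewrite subr_gt0 (le_lt_trans as_).
pose d := (b - a) / N.+1%:R; have d0 : 0 < d by rewrite divr_gt0.
pose y := (s - a) / d; have y0 : 0 <= y by rewrite divr_ge0 ?subr_ge0// ltW.
have sE : s = a + y * d by rewrite /y divfK ?gt_eqF// addrC subrK.
have /andP[h1 h2] := truncn_itv y0.
exists (Num.truncn y); last first.
  by rewrite /grid -/d sE lerD2l ltrD2l ler_pM2r// ltr_pM2r// h1.
rewrite -(@ltr_nat R) (le_lt_trans h1)// -(ltr_pM2r d0) /y divfK ?gt_eqF//.
by rewrite /d mulrC divfK ?pnatr_eq0// ltrD2r.
Qed.

Lemma overlap_grid N k l : overlap (grid N k) (grid N k.+1) (grid N l) (grid N l.+1) =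
  if k == l then (b - a) / N.+1%:R else 0.
Proof.
rewrite /overlap; case: (ltngtP k l) => [kl|lk|->].
- by rewrite max_l// subr_le0 ge_min !le_max (grid_mono N kl) ?orbT.
- by rewrite max_l// subr_le0 ge_min !le_max (grid_mono N lk) ?orbT.
- by rewrite minxx maxxx gridS max_r// divr_ge0// subr_ge0.
Qed.

End Grid.

Section GridApproximation.
Context {d : measure_display} {Omega : measurableType d} {R : realType}.
Variables (P : probability Omega R) (T : R) (F : R -> set (set Omega)).
Variables (m : nat) (w : 'I_m -> R -> Omega -> R).
Hypotheses (F_filtration : filtration T F) (w_wiener : wiener_process P T F w).
Variables (i : 'I_m) (a b : R).
Hypotheses (a0 : 0 <= a) (ab : a <= b) (bT : b <= T).

Local Notation L1 := (Lfun P 1).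
Local Notation L2 := (Lfun P 2%:E).

Definition grid_sum (N : nat) (v : nat -> Omega -> R) (x : Omega) : R :=
  \sum_(k < N.+1) v k x * incr w i (grid a b N k) (grid a b N k.+1) x.

Variables (N : nat) (v : nat -> Omega -> R).
Hypothesis mv : forall k, (k < N.+1)%N -> measurable_for (F (grid a b N k)) (v k).
Hypothesis v2 : forall k, (k < N.+1)%N -> v k \in L2.

Let eta := StepProcess N.+1 (grid a b N) v.

Let aeta : step_adapted P F a b eta.
Proof.
split; rewrite /= ?grid0 ?gridN// => k kN; first exact: grid_mono.
by split; [exact: mv|exact: v2].
Qed.

Lemma grid_sum_L2 : grid_sum N v \in L2.
Proof. exact: (step_integral_L2 F_filtration w_wiener i a0 bT aeta). Qed.

Let step_funE k s x : (k < N.+1)%N -> grid a b N k <= s < grid a b N k.+1 ->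
  step_fun eta s x = v k x.
Proof.
move=> kN sk; rewrite /step_fun (bigD1 (Ordinal kN))//= indicE mem_set ?mulr1//=.
rewrite big1 ?addr0// => l lk; rewrite indicE memNset ?mulr0//= in_itv/=.
move: sk => /andP[h1 h2] /andP[h3 h4]; move: lk; apply/negP; rewrite negbK.
apply/eqP/val_inj => /=; apply/eqP; rewrite eqn_leq; apply/andP; split.
  rewrite leqNgt; apply/negP => kl; have := grid_mono ab N kl.
  by rewrite leNgt (le_lt_trans h3).
rewrite leqNgt; apply/negP => kl; have := grid_mono ab N kl.
by rewrite leNgt (le_lt_trans h1).
Qed.

Lemma grid_approx (f : R -> Omega -> R) (X : Omega -> R) (e : R) :
  is_ito_integral P F (w i) a b f X -> 0 <= e ->
  (forall k s, (k < N.+1)%N -> grid a b N k <= s < grid a b N k.+1 ->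
     ('E_P[fun x => ((v k x - f s x) ^+ 2)%R] <= e%:E)%E) ->
  expect P (fun x => (X x - grid_sum N v x) ^+ 2) <= 4 * (e * (b - a)).
Proof.
move=> IX e0 H; have := ito_approx F_filtration w_wiener a0 bT IX aeta.
rewrite -lee_fin; move=> /le_trans; apply.
rewrite EFinM lee_pmul2l ?lte_fin//.
have mf : measurable_fun (`[a, b] `*` [set: Omega])
    (fun z : measurableTypeR R * Omega => f z.1 z.2) by case: IX => -[].
have mstep : measurable_fun (`[a, b] `*` [set: Omega])
    (fun z : measurableTypeR R * Omega => step_fun eta z.1 z.2).
  by apply: measurable_funTS; exact: (step_fun_measurable aeta).
have mD := measurable_distance P mstep mf.
have sub : (`[a, b[ : set (measurableTypeR R)) `<=` `[a, b].
  by move=> s /=; rewrite !in_itv/= => /andP[-> /ltW].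
rewrite -integral_itv_bndo_bndc; last first.
  by apply: (measurable_funS _ sub mD); exact: measurable_itv.
apply: (@le_trans _ _ (\int[lebesgue_measure]_(s in `[a, b[) e%:E)%E).
  apply: ge0_le_integral => //.
  - by move=> s _; apply: expectation_ge0 => x; exact: sqr_ge0.
  - by apply: (measurable_funS _ sub mD); exact: measurable_itv.
  - move=> s /=; rewrite in_itv/= => /(grid_locate N)[k kN sk].
    apply: le_trans (H k s kN sk); rewrite le_eqVlt; apply/orP; left; apply/eqP.
    by congr ('E_P[_])%E; apply/funext => x; rewrite (step_funE x kN sk).
rewrite integral_cst//= lebesgue_measure_itv/= lte_fin.
case: ifPn => _; first by rewrite -EFinB -EFinM.
by rewrite mule0 lee_fin mulr_ge0// subr_ge0.
Qed.

End GridApproximation.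

Section ItoOfOne.
Context {d : measure_display} {Omega : measurableType d} {R : realType}.
Variables (P : probability Omega R) (T : R) (F : R -> set (set Omega)).
Variables (m : nat) (w : 'I_m -> R -> Omega -> R).
Hypotheses (F_filtration : filtration T F) (w_wiener : wiener_process P T F w).

(** The grid with one interval approximates the constant [1] exactly, except at
    the endpoint [b]. *)
Lemma ito_integral1 (i : 'I_m) (a b : R) (X : Omega -> R) : 0 <= a -> a <= b -> b <= T ->
  is_ito_integral P F (w i) a b (fun _ _ => 1) X ->
  {ae P, forall x, X x = incr w i a b x}.
Proof.
move=> a0 ab bT IX; have X2 : X \in Lfun P 2%:E by case: IX => _ [xi [_ _ []]].
have W2 := incr_L2 F_filtration w_wiener i a0 ab bT.
have sF k : (k <= 1)%N -> sigma_algebra [set: Omega] (F (grid a b 0 k)).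
  move=> k1; apply: (filtration_sigma_algebra F_filtration).
  have /andP[h1 h2] := grid_itv ab k1.
  by rewrite (le_trans a0 h1) (le_trans h2 bT).
have := @grid_approx _ _ _ P T F m w F_filtration w_wiener i a b a0 ab bT 0
  (fun _ _ => 1) _ _ _ X 0 IX (lexx 0) _.
rewrite mul0r mulr0 => H.
have {}H : expect P (fun x => (X x - incr w i a b x) ^+ 2) = 0.
  apply/eqP; rewrite eq_le expect_sqr_ge0 andbT.
  have E : (fun x => (X x - grid_sum w i a b 0 (fun _ _ => 1) x) ^+ 2) =
      (fun x => (X x - incr w i a b x) ^+ 2).
    by apply/funext => x; rewrite /grid_sum big_ord1 mul1r grid0 gridN.
  rewrite -E; apply: H => [k k1|k _|k s _ _].
  - by apply: measurable_for_cst; apply: sF; exact: ltnW.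
  - exact: L2_cst.
  - rewrite subrr expr0n/= (_ : (fun=> 0) = cst 0)//.
    by rewrite expectation_cst.
have := expect_sqr_eq0 (L2B X2 W2) H.
by apply: filterS => x /eqP; rewrite subr_eq0 => /eqP.
Qed.

End ItoOfOne.

(** * Bilinear sums of increments of two components *)

Section IndependentComponents.
Context {d : measure_display} {Omega : measurableType d} {R : realType}.
Variables (P : probability Omega R) (T : R) (F : R -> set (set Omega)).
Variables (m : nat) (w : 'I_m -> R -> Omega -> R).
Hypotheses (F_filtration : filtration T F) (w_wiener : wiener_process P T F w).
Variables (i1 i2 : 'I_m).
Hypothesis i12 : i1 != i2.

Local Notation L1 := (Lfun P 1).
Local Notation L2 := (Lfun P 2%:E).

Lemma components_independent (A B : set Omega) :
  sigma_generated `[0, T] (w i1) A -> sigma_generated `[0, T] (w i2) B ->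
  P (A `&` B) = (P A * P B)%E.
Proof.
move=> mA mB; pose C i := if i == i1 then A else B.
have := wiener_components_independent w_wiener (D := [set i1; i2]%SET) (A := C).
rewrite big_setU1 ?inE//= big_set1 /C eqxx [i2 == i1]eq_sym (negPf i12).
move=> <-; last first.
  by move=> i; rewrite !inE => /orP[] /eqP ->; rewrite ?eqxx// [i2 == i1]eq_sym (negPf i12).
congr (P _); apply/seteqP; split=> x.
  move=> [xA xB] i /=; rewrite !inE => /orP[] /eqP ->; rewrite ?eqxx//.
  by rewrite [i2 == i1]eq_sym (negPf i12).
move=> xC; split.
  by have := xC i1; rewrite eqxx; apply; rewrite /= !inE eqxx.
by have := xC i2; rewrite [i2 == i1]eq_sym (negPf i12); apply; rewrite /= !inE eqxx orbT.
Qed.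

Lemma incr_sigma_generated (i : 'I_m) (r s : R) : 0 <= r <= T -> 0 <= s <= T ->
  measurable_for (sigma_generated `[0, T] (w i)) (incr w i r s).
Proof.
have sG : sigma_algebra [set: Omega] (sigma_generated `[0, T] (w i)).
  exact: smallest_sigma_algebra.
have mw u : 0 <= u <= T -> measurable_for (sigma_generated `[0, T] (w i)) (w i u).
  move=> uT B mB; apply: sub_sigma_algebra; exists u; first by rewrite /= in_itv.
  by exists B => //; rewrite setTI.
by move=> rT sT; apply: measurable_forB => //; exact: mw.
Qed.

Lemma components_expectM (X Y : Omega -> R) :
  measurable_for (sigma_generated `[0, T] (w i1)) X ->
  measurable_for (sigma_generated `[0, T] (w i2)) Y ->
  X \in L1 -> Y \in L1 ->
  (fun x => X x * Y x) \in L1 /\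
  expect P (fun x => X x * Y x) = expect P X * expect P Y.
Proof.
move=> mX mY X1 Y1; have mX' := L1_measurable X1; have mY' := L1_measurable Y1.
have ind A B : measurable A -> measurable B ->
    P (X @^-1` A `&` Y @^-1` B) = (P (X @^-1` A) * P (Y @^-1` B))%E.
  by move=> mA mB; apply: components_independent; [exact: mX|exact: mY].
by split; [exact: independent_L1M|exact: independent_expectM].
Qed.

Variables (a b : R) (N : nat).
Hypotheses (a0 : 0 <= a) (ab : a <= b) (bT : b <= T).

Definition gincr (i : 'I_m) (k : nat) : Omega -> R :=
  incr w i (grid a b N k) (grid a b N k.+1).

Let g0 k : (k <= N.+1)%N -> 0 <= grid a b N k <= T.
Proof.
move=> kN; have /andP[h1 h2] := grid_itv ab kN.
by rewrite (le_trans a0 h1) (le_trans h2 bT).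
Qed.

Lemma gincr_L2 (i : 'I_m) (k : 'I_N.+1) : gincr i k \in L2.
Proof.
have /andP[h1 _] := g0 (ltnW (ltn_ord k)); have /andP[_ h2] := g0 (ltn_ord k).
by apply: (incr_L2 F_filtration w_wiener) => //; exact: grid_mono.
Qed.

Lemma gincr_sigma_generated (i : 'I_m) (k : 'I_N.+1) :
  measurable_for (sigma_generated `[0, T] (w i)) (gincr i k).
Proof. by apply: incr_sigma_generated; apply: g0 => //; exact: ltnW. Qed.

Lemma expect_gincrM (i : 'I_m) (k l : 'I_N.+1) :
  expect P (fun x => gincr i k x * gincr i l x) =
  (k == l)%:R * ((b - a) / N.+1%:R).
Proof.
have /andP[h1 _] := g0 (ltnW (ltn_ord k)); have /andP[_ h2] := g0 (ltn_ord k).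
have /andP[h3 _] := g0 (ltnW (ltn_ord l)); have /andP[_ h4] := g0 (ltn_ord l).
have sF (j : 'I_N.+1) : sigma_algebra [set: Omega] (F (grid a b N j)).
  by apply: (filtration_sigma_algebra F_filtration); apply: g0; exact: ltnW.
have := expect_pieces F_filtration w_wiener i (u := fun=> 1) (v := fun=> 1)
  h1 (grid_mono ab N (leqnSn k)) h2 h3 (grid_mono ab N (leqnSn l)) h4
  (measurable_for_cst (sF k) 1) (measurable_for_cst (sF l) 1)
  (L2_cst _ _) (L2_cst _ _).
rewrite overlap_grid// mul1r expect_cst mul1r.
rewrite (_ : (fun x => 1 * _ * _) = (fun x => gincr i k x * gincr i l x)).
  move=> ->; rewrite -[_ == _ :> nat]/(k == l).
  by case: eqP => _; rewrite ?mul1r ?mul0r.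
by apply/funext => x; rewrite !mul1r.
Qed.

Lemma gincr_prod_L2 (l k : 'I_N.+1) :
  (fun x => gincr i1 l x * gincr i2 k x) \in L2.
Proof.
apply/L2P; split.
  by apply: measurable_funM; exact: (L2_measurable (gincr_L2 _ _)).
rewrite (_ : (fun x => _ ^+ 2) =
  (fun x => (gincr i1 l x * gincr i1 l x) * (gincr i2 k x * gincr i2 k x))); last first.
  by apply/funext => x; ring.
have sG i : sigma_algebra [set: Omega] (sigma_generated `[0, T] (w i)).
  exact: smallest_sigma_algebra.
apply: (components_expectM _ _ _ _).1.
- by apply: measurable_forM => //; exact: gincr_sigma_generated.
- by apply: measurable_forM => //; exact: gincr_sigma_generated.
- by apply: L2M; exact: gincr_L2.
- by apply: L2M; exact: gincr_L2.
Qed.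

(** By independence of the two components, products of increments form an
    orthogonal family. *)
Lemma expect_gincr_prod (l k l' k' : 'I_N.+1) :
  expect P (fun x => (gincr i1 l x * gincr i2 k x) * (gincr i1 l' x * gincr i2 k' x)) =
  (l == l')%:R * (k == k')%:R * ((b - a) / N.+1%:R) ^+ 2.
Proof.
have sG i : sigma_algebra [set: Omega] (sigma_generated `[0, T] (w i)).
  exact: smallest_sigma_algebra.
rewrite (_ : (fun x => _) =
  (fun x => (gincr i1 l x * gincr i1 l' x) * (gincr i2 k x * gincr i2 k' x))); last first.
  by apply/funext => x; ring.
rewrite (components_expectM _ _ _ _).2.
- by rewrite !expect_gincrM; ring.
- by apply: measurable_forM => //; exact: gincr_sigma_generated.
- by apply: measurable_forM => //; exact: gincr_sigma_generated.
- by apply: L2M; exact: gincr_L2.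
- by apply: L2M; exact: gincr_L2.
Qed.

Definition bilinear_sum (K : nat -> nat -> R) (x : Omega) : R :=
  \sum_(l < N.+1) \sum_(k < N.+1) K l k * (gincr i1 l x * gincr i2 k x).

Lemma bilinear_sum_L2 K : bilinear_sum K \in L2.
Proof.
by apply: L2_sum => l; apply: L2_sum => k; apply: L2Z; exact: gincr_prod_L2.
Qed.

Lemma expect_bilinear_sum_sqr K :
  expect P (fun x => bilinear_sum K x ^+ 2) =
  ((b - a) / N.+1%:R) ^+ 2 * \sum_(l < N.+1) \sum_(k < N.+1) K l k ^+ 2.
Proof.
pose G (q : 'I_N.+1 * 'I_N.+1) x := gincr i1 q.1 x * gincr i2 q.2 x.
have E x : bilinear_sum K x = \sum_(q : 'I_N.+1 * 'I_N.+1) K q.1 q.2 * G q x.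
  by rewrite /bilinear_sum pair_big.
have G1 (p q : 'I_N.+1 * 'I_N.+1) : (fun x => K p.1 p.2 * K q.1 q.2 * (G p x * G q x)) \in L1.
  by apply: L1Z; apply: L2M; exact: gincr_prod_L2.
rewrite (_ : (fun x => _ ^+ 2) =
    (fun x => \sum_(p : 'I_N.+1 * 'I_N.+1) \sum_(q : 'I_N.+1 * 'I_N.+1) K p.1 p.2 * K q.1 q.2 * (G p x * G q x))); last first.
  apply/funext => x; rewrite E expr2 big_distrlr/=.
  by apply: eq_bigr => p _; apply: eq_bigr => q _; ring.
rewrite expect_sum; last by move=> p; exact: L1_sum.
rewrite pair_big/= mulr_sumr; apply: eq_bigr => p _; rewrite expect_sum//.
rewrite (bigD1 p)//= big1 ?addr0.
  rewrite expectZ; last by apply: L2M; exact: gincr_prod_L2.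
  rewrite expect_gincr_prod !eqxx /=; ring.
move=> q qp; rewrite expectZ; last by apply: L2M; exact: gincr_prod_L2.
rewrite expect_gincr_prod -natrM mulnb.
by move: qp; rewrite eq_sym -[_ && _]/(p == q) => /negPf ->; rewrite mul0r mulr0.
Qed.

End IndependentComponents.

(** * Convergence of the discretised Levy area *)

Section MeanConvergence.
Context {d : measure_display} {Omega : measurableType d} {R : realType}.
Variable P : probability Omega R.
Local Notation L1 := (Lfun P 1).
Local Notation L2 := (Lfun P 2%:E).

Definition mean_cvg (X : nat -> Omega -> R) (X0 : Omega -> R) : Prop :=
  [/\ forall n, X n \in L1, X0 \in L1
    & expect P (fun x => `|X n x - X0 x|) @[n --> \oo] --> (0 : R)].

Lemma mean_cvgD X X0 Y Y0 : mean_cvg X X0 -> mean_cvg Y Y0 ->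
  mean_cvg (fun n x => X n x + Y n x) (fun x => X0 x + Y0 x).
Proof.
move=> [X1 X01 cX] [Y1 Y01 cY]; split=> [n| |]; [exact: L1D|exact: L1D|].
apply: (@squeeze_cvgr _ _ _ _ (fun=> 0) (fun n =>
  expect P (fun x => `|X n x - X0 x|) + expect P (fun x => `|Y n x - Y0 x|))).
- apply: nearW => n; rewrite expect_ge0//= -expectD; last 2 first.
  + by apply/L1_norm/L1B.
  + by apply/L1_norm/L1B.
  apply: expect_le.
  + by apply/L1_norm/L1B; exact: L1D.
  + by apply: L1D; apply/L1_norm/L1B.
  + by move=> x; rewrite opprD addrACA ler_normD.
- exact: cvg_cst.
- by rewrite -[X in _ --> X](addr0 (0 : R)); apply: cvgD.
Qed.

Lemma mean_cvgZ c X X0 : mean_cvg X X0 ->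
  mean_cvg (fun n x => c * X n x) (fun x => c * X0 x).
Proof.
move=> [X1 X01 cX]; split=> [n| |]; [exact: L1Z|exact: L1Z|].
rewrite (_ : (fun n => _) = (fun n => `|c| * expect P (fun x => `|X n x - X0 x|))).
  by rewrite -[X in _ --> X](mulr0 `|c|); apply: cvgM => //; exact: cvg_cst.
apply/funext => n; rewrite -expectZ; last exact/L1_norm/L1B.
by congr expect; apply/funext => x; rewrite -mulrBr normrM.
Qed.

Lemma mean_cvgB X X0 Y Y0 : mean_cvg X X0 -> mean_cvg Y Y0 ->
  mean_cvg (fun n x => X n x - Y n x) (fun x => X0 x - Y0 x).
Proof.
move=> cX /(mean_cvgZ (-1)) cY; have := mean_cvgD cX cY.
rewrite (_ : (fun x => X0 x + _) = (fun x => X0 x - Y0 x)).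
  rewrite (_ : (fun n x => X n x + _) = (fun n x => X n x - Y n x))//.
  by apply/funext => n; apply/funext => x; rewrite mulN1r.
by apply/funext => x; rewrite mulN1r.
Qed.

Lemma mean_cvg_sum n (X : nat -> nat -> Omega -> R) (X0 : nat -> Omega -> R) :
  (forall j, mean_cvg (X j) (X0 j)) ->
  mean_cvg (fun N x => \sum_(0 <= j < n) X j N x) (fun x => \sum_(0 <= j < n) X0 j x).
Proof.
move=> cX; elim: n => [|n IH].
  rewrite (_ : (fun x => _) = fun=> 0); last by apply/funext => x; rewrite big_geq.
  rewrite (_ : (fun N x => _) = fun _ _ => 0); last first.
    by apply/funext => N; apply/funext => x; rewrite big_geq.
  split=> [N| |]; [exact: L1_cst|exact: L1_cst|].
  rewrite (_ : (fun N => _) = fun=> 0); first exact: cvg_cst.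
  by apply/funext => N; rewrite subrr normr0 expect_cst.
rewrite (_ : (fun x => _) = (fun x => \sum_(0 <= j < n) X0 j x + X0 n x)); last first.
  by apply/funext => x; rewrite big_nat_recr.
rewrite (_ : (fun N x => _) = (fun N x => \sum_(0 <= j < n) X j N x + X n N x)); last first.
  by apply/funext => N; apply/funext => x; rewrite big_nat_recr.
exact: mean_cvgD.
Qed.

Lemma mean_cvgM X X0 Y Y0 :
  (forall n, X n \in L2) -> (forall n, Y n \in L2) -> X0 \in L2 -> Y0 \in L2 ->
  norm2 P (fun x => X n x - X0 x) @[n --> \oo] --> (0 : R) ->
  norm2 P (fun x => Y n x - Y0 x) @[n --> \oo] --> (0 : R) ->
  mean_cvg (fun n x => X n x * Y n x) (fun x => X0 x * Y0 x).
Proof.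
move=> X2 Y2 X02 Y02 cX cY.
split=> [n| |]; [exact: L2M|exact: L2M|exact: expect_cvgM].
Qed.

Lemma mean_cvg_norm2 X X0 : (forall n, X n \in L2) -> X0 \in L2 ->
  norm2 P (fun x => X n x - X0 x) @[n --> \oo] --> (0 : R) -> mean_cvg X X0.
Proof.
move=> X2 X02 cX; have := @mean_cvgM X X0 (fun _ _ => 1) (fun=> 1) X2
  (fun=> L2_cst P 1) X02 (L2_cst P 1) cX.
rewrite (_ : (fun x => X0 x * 1) = X0); last by apply/funext => x; rewrite mulr1.
rewrite (_ : (fun n x => X n x * 1) = X); last first.
  by apply/funext => n; apply/funext => x; rewrite mulr1.
apply; rewrite (_ : (fun n => _) = fun=> 0); first exact: cvg_cst.
by apply/funext => n; rewrite /norm2 subrr expr0n/= expect_cst sqrtr0.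
Qed.

End MeanConvergence.

Section GridConvergence.
Context {d : measure_display} {Omega : measurableType d} {R : realType}.
Variables (P : probability Omega R) (T : R) (F : R -> set (set Omega)).
Variables (m : nat) (w : 'I_m -> R -> Omega -> R).
Hypotheses (F_filtration : filtration T F) (w_wiener : wiener_process P T F w).
Variable t : R.
Hypotheses (t0 : 0 <= t) (tT : t < T).

Local Notation L2 := (Lfun P 2%:E).
Local Notation tau := (grid t T).

Let tau_itv N k : (k <= N.+1)%N -> 0 <= tau N k <= T.
Proof.
move=> kN; have /andP[h1 h2] := grid_itv (ltW tT) kN.
by rewrite (le_trans t0 h1).
Qed.

Lemma ito_L2 i f a b X : is_ito_integral P F (w i) a b f X -> X \in L2.
Proof. by case=> _ [xi [_ _ []]]. Qed.

Lemma grid_sum_cvg (i : 'I_m) (v : nat -> nat -> Omega -> R) f X (e : nat -> R) :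
  is_ito_integral P F (w i) t T f X ->
  (forall N k, (k < N.+1)%N -> measurable_for (F (tau N k)) (v N k)) ->
  (forall N k, (k < N.+1)%N -> v N k \in L2) ->
  (forall N, 0 <= e N) -> e @ \oo --> (0 : R) ->
  (forall N k s, (k < N.+1)%N -> tau N k <= s < tau N k.+1 ->
     ('E_P[fun x => ((v N k x - f s x) ^+ 2)%R] <= (e N)%:E)%E) ->
  norm2 P (fun x => grid_sum w i t T N (v N) x - X x) @[N --> \oo] --> (0 : R).
Proof.
move=> IX mv v2 e0 ce H.
have c1 : Num.sqrt (4 * (e N * (T - t))) @[N --> \oo] --> (0 : R).
  rewrite -[X in _ --> X]sqrtr0; apply: continuous_cvg; first exact: sqrt_continuous.
  rewrite [X in _ --> X](_ : 0 = 4 * (0 * (T - t))); last by rewrite mul0r mulr0.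
  apply: cvgM; first exact: cvg_cst.
  by apply: cvgM => //; exact: cvg_cst.
apply: (@squeeze_cvgr _ _ _ _ (fun=> 0) _ _ _ _ _ c1); last exact: cvg_cst.
apply: nearW => N; rewrite sqrtr_ge0/= ler_wsqrtr//.
rewrite (_ : (fun x => _) = (fun x => (X x - grid_sum w i t T N (v N) x) ^+ 2)).
  apply: (grid_approx F_filtration w_wiener t0 (ltW tT) (lexx T) _ _ IX (e0 N)).
  - by move=> k kN; exact: mv.
  - by move=> k kN; exact: v2.
  - by move=> k s kN; exact: H.
by apply/funext => x; rewrite -sqrrN opprB.
Qed.

Lemma poly_lipschitz (p : {poly R}) : exists2 L : R, 0 <= L & forall x y,
  -1 <= x <= 1 -> -1 <= y <= 1 -> `|p.[y] - p.[x]| <= L * `|y - x|.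
Proof.
have [C C0 HC] := poly_taylor1 p; have [M M0 HM] := poly_bounded p^`().
exists (2 * C + M); first by rewrite addr_ge0// mulr_ge0.
move=> x y x1 y1; have yx : `|y - x| <= 2.
  move: x1 y1 => /andP[h1 h2] /andP[h3 h4].
  by rewrite ler_norml; apply/andP; split; lra.
rewrite -[p.[y] - p.[x]](subrK ((y - x) * p^`().[x])) (le_trans (ler_normD _ _))//.
rewrite [leRHS]mulrDl lerD//.
  apply: le_trans (HC _ _ x1 y1) _; rewrite -real_normK ?num_real// expr2.
  by rewrite mulrA ler_wpM2r// [leRHS]mulrC ler_wpM2l// mulrC.
by rewrite normrM mulrC ler_wpM2r// HM.
Qed.

Lemma legendre_fun_grid N j k :
  legendre_fun t T j (tau N k) =
  Num.sqrt ((2 * j + 1)%:R / (T - t)) * (legendre j).[node N k].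
Proof.
rewrite /legendre_fun; congr (_ * _.[_]); rewrite /grid /node.
have : T - t != 0 by rewrite subr_eq0 gt_eqF.
have : N.+1%:R != 0 :> R by rewrite pnatr_eq0.
by move: (N.+1%:R : R) (T - t) => x h x0 h0; field; rewrite x0 h0.
Qed.

Lemma zeta_cvg (i : 'I_m) (j : nat) X :
  is_ito_integral P F (w i) t T (fun s _ => legendre_fun t T j s) X ->
  norm2 P (fun x => grid_sum w i t T N (fun k _ => legendre_fun t T j (tau N k)) x - X x)
    @[N --> \oo] --> (0 : R).
Proof.
move=> IX; have h0 : 0 < T - t by rewrite subr_gt0.
have [L L0 HL] := poly_lipschitz (legendre j).
pose c := Num.sqrt ((2 * j + 1)%:R / (T - t)) * L * 2.
pose e N := (c * harmonic N) ^+ 2.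
apply: (@grid_sum_cvg i _ _ X e IX).
- by move=> N k kN; apply: measurable_for_cst; apply: (filtration_sigma_algebra F_filtration);
    apply: tau_itv; exact: ltnW.
- by move=> N k kN; exact: L2_cst.
- by move=> N; exact: sqr_ge0.
- rewrite [X in _ --> X](_ : 0 = (c * 0) ^+ 2); last by rewrite mulr0 expr0n.
  rewrite /e; under eq_fun do rewrite expr2.
  rewrite expr2; apply: cvgM; apply: cvgM; try exact: cvg_cst; exact: cvg_harmonic.
- move=> N k s kN /andP[ks sk].
  have -> : (fun x : Omega => (legendre_fun t T j (tau N k) - legendre_fun t T j s) ^+ 2)
    = cst ((legendre_fun t T j (tau N k) - legendre_fun t T j s) ^+ 2) by [].
  rewrite expectation_cst lee_fin /e -(real_normK (num_real (_ - _))).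
  rewrite ler_pXn2r ?nnegrE ?mulr_ge0 ?invr_ge0//.
  rewrite legendre_fun_grid /legendre_fun -mulrBr normrM ger0_norm//.
  rewrite /c -!mulrA ler_wpM2l//.
  set y := (_ - _) * _.
  have yE : y - node N k = (s - tau N k) * (2 / (T - t)).
    rewrite /y /node /grid.
    have : T - t != 0 by rewrite gt_eqF.
    have : N.+1%:R != 0 :> R by rewrite pnatr_eq0.
    by move: (N.+1%:R : R) (T - t) => x h x0 h1; field; rewrite x0 h1.
  have d0 : 0 <= y - node N k.
    by rewrite yE mulr_ge0 ?subr_ge0// divr_ge0// ltW.
  have d1 : y - node N k <= 2 * harmonic N.
    rewrite yE mulrA ler_pdivrMr// [leLHS]mulrC.
    rewrite /harmonic -mulrA ler_pM2l// mulrC -(gridS t T N k).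
    by rewrite lerB// ltW.
  have y1 : -1 <= y <= 1.
    have /andP[n1 _] := @node_itv R N k (ltnW kN).
    have /andP[_ n2] := @node_itv R N k.+1 kN.
    apply/andP; split; first by rewrite -[y](subrK (node N k)) (le_trans n1)// lerDr.
    apply: le_trans n2; rewrite -(subrK (node N k) (node N k.+1)) nodeS.
    by rewrite -lerBlDr.
  rewrite distrC; apply: le_trans (HL _ _ (node_itv (ltnW kN)) y1) _.
  by rewrite ler_wpM2l// ger0_norm.
Qed.

(** The inner integral over [[t, s]] is [w i s - w i t] almost surely, so the outer
    integrand moves by the increment over [[tau N k, s]], of variance at most the
    mesh, between two points of the grid. *)
Lemma iterated_cvg (i i' : 'I_m) X :
  is_iterated_ito_integral P F (w i) (w i') t T X ->
  X \in L2 /\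
  norm2 P (fun x => grid_sum w i' t T N (fun k => incr w i t (tau N k)) x - X x)
    @[N --> \oo] --> (0 : R).
Proof.
move=> [J [IJ IX]]; split; first exact: ito_L2 IX.
have h0 : 0 < T - t by rewrite subr_gt0.
apply: (@grid_sum_cvg i' _ _ X (fun N => (T - t) * harmonic N) IX).
- move=> N k kN; have /andP[h1 h2] := grid_itv (ltW tT) (ltnW kN).
  exact: (incr_measurable_for F_filtration w_wiener).
- move=> N k kN; have /andP[h1 h2] := grid_itv (ltW tT) (ltnW kN).
  exact: (incr_L2 F_filtration w_wiener).
- by move=> N; rewrite mulr_ge0 ?invr_ge0// ltW.
- rewrite -[X in _ --> X](mulr0 (T - t)); apply: cvgM; first exact: cvg_cst.
  exact: cvg_harmonic.
- move=> N k s kN /andP[ks sk].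
  have /andP[h1 h2] := grid_itv (ltW tT) (ltnW kN).
  have /andP[h3 h4] := grid_itv (ltW tT) kN.
  have ts : t <= s by exact: le_trans ks.
  have sT : s <= T by exact: (le_trans (ltW sk)).
  have k0 : 0 <= tau N k by exact: le_trans h1.
  have Is : is_ito_integral P F (w i) t s (fun _ _ => 1) (J s) by apply: IJ; rewrite ts.
  have JE := ito_integral1 F_filtration w_wiener t0 ts sT Is.
  have mW r : t <= r -> r <= T -> measurable_fun [set: Omega] (incr w i t r).
    by move=> tr rT; exact: (incr_measurable F_filtration w_wiener).
  have mJ := L2_measurable (ito_L2 Is).
  rewrite (expect_ae_eq (Y := fun x => incr w i (tau N k) s x ^+ 2)).
  + rewrite expectE; last by apply: L2_sqr; exact: (incr_L2 F_filtration w_wiener).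
    rewrite (incr_expect_sqr F_filtration w_wiener)// lee_fin.
    by rewrite /harmonic -(gridS t T N k) lerB// ltW.
  + by apply: measurable_funX; apply: measurable_funB => //; exact: mW.
  + by apply: measurable_funX; exact: (incr_measurable F_filtration w_wiener).
  + by apply: filterS JE => x ->; rewrite -[RHS]sqrrN /incr; congr (_ ^+ 2); ring.
Qed.

End GridConvergence.

Section BilinearSums.
Context {d : measure_display} {Omega : measurableType d} {R : realType} {m : nat}.
Variables (w : 'I_m -> R -> Omega -> R) (i1 i2 : 'I_m) (a b : R) (N : nat).
Local Notation bs := (bilinear_sum w i1 i2 a b N).
Implicit Types K L : nat -> nat -> R.

Lemma bilinear_sumB K L x : bs (fun l k => K l k - L l k) x = bs K x - bs L x.
Proof.
rewrite /bilinear_sum -sumrB; apply: eq_bigr => l _.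
by rewrite -sumrB; apply: eq_bigr => k _; rewrite mulrBl.
Qed.

Lemma bilinear_sumZ c K x : bs (fun l k => c * K l k) x = c * bs K x.
Proof.
rewrite /bilinear_sum mulr_sumr; apply: eq_bigr => l _.
by rewrite mulr_sumr; apply: eq_bigr => k _; rewrite -mulrA.
Qed.

Lemma bilinear_sum_sum n (K : nat -> nat -> nat -> R) x :
  bs (fun l k => \sum_(0 <= j < n) K j l k) x = \sum_(0 <= j < n) bs (K j) x.
Proof.
rewrite /bilinear_sum [RHS]exchange_big/=; apply: eq_bigr => l _.
rewrite [RHS]exchange_big/=; apply: eq_bigr => k _.
by rewrite mulr_suml.
Qed.

Lemma bilinear_sum_prod (f g : nat -> R) x :
  bs (fun l k => f l * g k) x =
  grid_sum w i1 a b N (fun k _ => f k) x * grid_sum w i2 a b N (fun k _ => g k) x.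
Proof.
rewrite /bilinear_sum /grid_sum big_distrlr/=; apply: eq_bigr => l _.
by apply: eq_bigr => k _; rewrite /gincr; ring.
Qed.

(** The sum over [l < k] is written over all [l] to match [bilinear_sum]. *)
Let telescope_incr (i : 'I_m) (k : 'I_N.+1) x :
  incr w i a (grid a b N k) x = \sum_(l < N.+1) (l < k)%N%:R * gincr w a b N i l x.
Proof.
transitivity (\sum_(0 <= l < k) gincr w a b N i l x).
  by rewrite /gincr /incr telescope_sumr// grid0.
rewrite (@big_nat_widen _ _ _ 0 k N.+1)/=; last by rewrite ltnW.
rewrite big_mkord big_mkcond/=; apply: eq_bigr => l _.
by case: ifP => _; rewrite ?mul1r ?mul0r.
Qed.

Lemma bilinear_sum_lt x : bs (fun l k => (l < k)%N%:R) x =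
  grid_sum w i2 a b N (fun k => incr w i1 a (grid a b N k)) x.
Proof.
rewrite /bilinear_sum /grid_sum exchange_big/=; apply: eq_bigr => k _.
rewrite telescope_incr mulr_suml; apply: eq_bigr => l _.
by rewrite mulrA.
Qed.

Lemma bilinear_sum_gt x : bs (fun l k => (k < l)%N%:R) x =
  grid_sum w i1 a b N (fun k => incr w i2 a (grid a b N k)) x.
Proof.
rewrite /bilinear_sum /grid_sum; apply: eq_bigr => k _.
rewrite telescope_incr mulr_suml; apply: eq_bigr => l _.
by rewrite /gincr; ring.
Qed.

End BilinearSums.

Section LevyArea.
Context {d : measure_display} {Omega : measurableType d} {R : realType}.
Variables (P : probability Omega R) (T : R) (F : R -> set (set Omega)).
Variables (m : nat) (w : 'I_m -> R -> Omega -> R).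
Hypotheses (F_filtration : filtration T F) (w_wiener : wiener_process P T F w).
Variables (t : R) (i1 i2 : 'I_m) (zeta : 'I_m -> nat -> Omega -> R).
Variables (I12 I21 : Omega -> R).
Hypotheses (t0 : 0 <= t) (tT : t < T) (i12 : i1 != i2).
Hypothesis zetaE : forall (i : 'I_m) (j : nat),
  is_ito_integral P F (w i) t T (fun s _ => legendre_fun t T j s) (zeta i j).
Hypothesis I12E : is_iterated_ito_integral P F (w i1) (w i2) t T I12.
Hypothesis I21E : is_iterated_ito_integral P F (w i2) (w i1) t T I21.

Local Notation L2 := (Lfun P 2%:E).
Local Notation bs := (bilinear_sum w i1 i2 t T).

Let h_gt0 : 0 < T - t. Proof. by rewrite subr_gt0. Qed.

Definition levy_term (z : 'I_m -> nat -> Omega -> R) (j : nat) (x : Omega) : R :=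
  (Num.sqrt (4 * j.+1%:R ^+ 2 - 1))^-1 *
  (z i1 j x * z i2 j.+1 x - z i1 j.+1 x * z i2 j x).

Definition levy_error n (x : Omega) : R := 2^-1 * (I12 x - I21 x) -
  (T - t) / 2 * \sum_(0 <= j < n) levy_term zeta j x.

Let zetaN N (i : 'I_m) (j : nat) : Omega -> R :=
  grid_sum w i t T N (fun k _ => legendre_fun t T j (grid t T N k)).

(** The normalizing factors of two consecutive Legendre functions cancel the
    coefficient of the series. *)
Let levy_term_kernel N j x : (T - t) * levy_term (zetaN N) j x =
  bs N (fun l k => (legendre j).[node N l] * (legendre j.+1).[node N k] -
    (legendre j.+1).[node N l] * (legendre j).[node N k]) x.
Proof.
rewrite /levy_term /zetaN -!bilinear_sum_prod -bilinear_sumB.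
rewrite -!bilinear_sumZ; congr bilinear_sum.
apply/funext => l; apply/funext => k; rewrite !legendre_fun_grid//.
have -> : 4 * j.+1%:R ^+ 2 - 1 = (2 * j + 1)%:R * (2 * j.+1 + 1)%:R :> R.
  by rewrite !natrD !natrM -(natr1 j); ring.
set p : R := (2 * j + 1)%:R; set q : R := (2 * j.+1 + 1)%:R.
have p0 : 0 < p by rewrite ltr0n addn1.
have q0 : 0 < q by rewrite ltr0n addn1.
rewrite !sqrtrM ?ltW//.
have sp : Num.sqrt p != 0 by rewrite gt_eqF// sqrtr_gt0.
have sq : Num.sqrt q != 0 by rewrite gt_eqF// sqrtr_gt0.
have E : Num.sqrt (T - t)^-1 ^+ 2 = (T - t)^-1 by rewrite sqr_sqrtr// invr_ge0 ltW.
have h0 : T - t != 0 by rewrite gt_eqF.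
move: (Num.sqrt (T - t)^-1) (Num.sqrt p) (Num.sqrt q) sp sq E => r u v u0 v0 E.
transitivity ((T - t) * r ^+ 2 * ((legendre j).[node N l] * (legendre j.+1).[node N k] -
    (legendre j.+1).[node N l] * (legendre j).[node N k])).
  by field; rewrite u0 v0.
by rewrite E divff// mul1r.
Qed.

Let errorN N n x : R := 2^-1 *
    (grid_sum w i2 t T N (fun k => incr w i1 t (grid t T N k)) x -
     grid_sum w i1 t T N (fun k => incr w i2 t (grid t T N k)) x) -
  (T - t) / 2 * \sum_(0 <= j < n) levy_term (zetaN N) j x.

Let errorN_kernel N n x :
  errorN N n x = bs N (fun l k => 2^-1 * levy_kernel N n l k) x.
Proof.
rewrite bilinear_sumZ /levy_kernel bilinear_sumB bilinear_sum_sum.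
rewrite /sg bilinear_sumB bilinear_sum_lt bilinear_sum_gt /errorN.
rewrite [X in _ = X]mulrBr; congr (_ - _).
rewrite [(T - t) / 2]mulrC -mulrA; congr (_ * _); rewrite mulr_sumr.
by apply: eq_bigr => j _; exact: levy_term_kernel.
Qed.

Let errorN_L2 N n : errorN N n \in L2.
Proof.
rewrite (_ : errorN N n = bs N (fun l k => 2^-1 * levy_kernel N n l k)).
  exact: (bilinear_sum_L2 F_filtration w_wiener i12 N t0 (ltW tT) (lexx T)).
by apply/funext => x; exact: errorN_kernel.
Qed.

Let expect_errorN_sqr N n : expect P (fun x => errorN N n x ^+ 2) =
  (T - t) ^+ 2 / 16 * dsum N (fun l k => levy_kernel N n l k ^+ 2).
Proof.
rewrite (_ : (fun x => _) =
    (fun x => bs N (fun l k => 2^-1 * levy_kernel N n l k) x ^+ 2)); last first.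
  by apply/funext => x; rewrite errorN_kernel.
rewrite (expect_bilinear_sum_sqr F_filtration w_wiener i12 N t0 (ltW tT) (lexx T)).
rewrite /dsum mulrA.
rewrite (_ : (T - t) ^+ 2 / 16 * (2 / N.+1%:R) ^+ 2 =
  ((T - t) / N.+1%:R) ^+ 2 * (2^-1 ^+ 2)); last first.
  have : N.+1%:R != 0 :> R by rewrite pnatr_eq0.
  by move: (N.+1%:R : R) => y y0; field.
rewrite -mulrA; congr (_ * _); rewrite mulr_sumr; apply: eq_bigr => l _.
by rewrite mulr_sumr; apply: eq_bigr => k _; rewrite exprMn.
Qed.

Let zeta_L2 i j : zeta i j \in L2. Proof. exact: ito_L2 (zetaE i j). Qed.

Let zetaN_L2 N i j : zetaN N i j \in L2.
Proof.
apply: (grid_sum_L2 F_filtration w_wiener i t0 (ltW tT) (lexx T)) => k kN.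
  apply: measurable_for_cst; apply: (filtration_sigma_algebra F_filtration).
  have /andP[h1 h2] := grid_itv (ltW tT) (ltnW kN).
  by rewrite (le_trans t0 h1).
exact: L2_cst.
Qed.

Let iterN_L2 N i i' : grid_sum w i' t T N (fun k => incr w i t (grid t T N k)) \in L2.
Proof.
apply: (grid_sum_L2 F_filtration w_wiener i' t0 (ltW tT) (lexx T)) => k kN.
  have /andP[h1 h2] := grid_itv (ltW tT) (ltnW kN).
  exact: (incr_measurable_for F_filtration w_wiener).
have /andP[h1 h2] := grid_itv (ltW tT) (ltnW kN).
exact: (incr_L2 F_filtration w_wiener).
Qed.

Let error_cvg n : mean_cvg P (fun N => errorN N n) (levy_error n).
Proof.
have [I12_L2 c12] := iterated_cvg F_filtration w_wiener t0 tT I12E.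
have [I21_L2 c21] := iterated_cvg F_filtration w_wiener t0 tT I21E.
have cz i j := zeta_cvg F_filtration w_wiener t0 tT (zetaE i j).
apply: mean_cvgB.
  apply: mean_cvgZ; apply: mean_cvgB; apply: mean_cvg_norm2 => //.
apply: mean_cvgZ; apply: mean_cvg_sum => j; apply: mean_cvgZ.
by apply: mean_cvgB; apply: mean_cvgM => //; exact: cz.
Qed.

(** The errors [errorN N n] of the discretised expansion have a second moment
    that is an explicit double sum and tends to the right-hand side; the bound
    passes to the limit by lower semicontinuity. *)
Lemma expect_levy_error n : levy_error n \in L2 /\
  expect P (fun x => levy_error n x ^+ 2) <= (T - t) ^+ 2 / (4 * (2 * n + 1)%:R).
Proof.
have [_ e1 ce] := error_cvg n.
have := expect_sqr_le_cvg (fun N => errorN_L2 N n) e1 ce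
  (c := fun N => (T - t) ^+ 2 / 16 * dsum N (fun l k => levy_kernel N n l k ^+ 2))
  (l := (T - t) ^+ 2 / 16 * (4 / (2 * n + 1)%:R)).
rewrite (_ : _ / 16 * (4 / _) = (T - t) ^+ 2 / (4 * (2 * n + 1)%:R)).
  apply=> [N|]; first by rewrite expect_errorN_sqr.
  rewrite (_ : _ / (4 * _) = (T - t) ^+ 2 / 16 * (4 / (2 * n + 1)%:R)).
    by apply: cvgM; [exact: cvg_cst|exact: levy_kernel_cvg].
  have : (2 * n + 1)%:R != 0 :> R by rewrite pnatr_eq0 addn1.
  by move: ((2 * n + 1)%:R : R) => y y0; field.
have : (2 * n + 1)%:R != 0 :> R by rewrite pnatr_eq0 addn1.
by move: ((2 * n + 1)%:R : R) => y y0; field.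
Qed.

Lemma levy_area_expansion : mean_square_cvg P
  (fun n x => (T - t) / 2 * \sum_(0 <= j < n) levy_term zeta j x)
  (fun x => 2^-1 * (I12 x - I21 x)).
Proof.
have [I12_L2 _] := iterated_cvg F_filtration w_wiener t0 tT I12E.
have [I21_L2 _] := iterated_cvg F_filtration w_wiener t0 tT I21E.
have A2 : (fun x => 2^-1 * (I12 x - I21 x)) \in L2 by apply: L2Z; exact: L2B.
split=> // [n|].
  have [e2 _] := expect_levy_error n.
  rewrite (_ : (fun x => _) = (fun x => 2^-1 * (I12 x - I21 x) - levy_error n x)).
    exact: L2B.
  by apply/funext => x; rewrite /levy_error subKr.
have E n : ('E_P[fun x => (((T - t) / 2 * (\sum_(0 <= j < n) levy_term zeta j x) -
    2^-1 * (I12 x - I21 x)) ^+ 2)%R] =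
    (expect P (fun x => levy_error n x ^+ 2))%:E)%E.
  have [e2 _] := expect_levy_error n.
  rewrite -expectE; last exact: L2_sqr.
  by congr ('E_P[_])%E; apply/funext => x; rewrite -sqrrN opprB.
rewrite (_ : (fun n => _) = (fun n => (expect P (fun x => levy_error n x ^+ 2))%:E)).
  apply/cvg_EFin; [by apply: nearW|].
  apply: (@squeeze_cvgr _ _ _ _ (fun=> 0) (fun n => (T - t) ^+ 2 * harmonic n)).
  - apply: nearW => n; rewrite expect_sqr_ge0/=.
    apply: le_trans (expect_levy_error n).2 _.
    rewrite ler_wpM2l ?sqr_ge0// /harmonic lef_pV2 ?posrE ?mulr_gt0// ?ltr0n ?addn1//.
    by rewrite -natrM ler_nat; lia.
  - exact: cvg_cst.
  - rewrite -[X in _ --> X](mulr0 ((T - t) ^+ 2)); apply: cvgM; first exact: cvg_cst.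
    exact: cvg_harmonic.
by apply/funext => n; exact: E.
Qed.

End LevyArea.

Theorem mainTheorem2 (R : realType) (d : measure_display)
    (Omega : measurableType d) (P : probability Omega R)
    (F : R -> set (set Omega)) (m : nat) (w : 'I_m -> R -> Omega -> R)
    (t T : R) (i1 i2 : 'I_m) (zeta : 'I_m -> nat -> Omega -> R)
    (I : 'I_m -> 'I_m -> Omega -> R)
    (P_complete : measure_is_complete P)
    (F_filtration : filtration T F)
    (w_wiener : wiener_process P T F w)
    (t_ge0 : 0 <= t) (t_lt_T : t < T) (i1_neq_i2 : i1 != i2)
    (zetaE : forall (i : 'I_m) (j : nat),
       is_ito_integral P F (w i) t T (fun s _ => legendre_fun t T j s)
         (zeta i j))
    (I12E : is_iterated_ito_integral P F (w i1) (w i2) t T (I i1 i2))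
    (I21E : is_iterated_ito_integral P F (w i2) (w i1) t T (I i2 i1)) :
  let A := fun x : Omega => 2^-1 * (I i1 i2 x - I i2 i1 x) in
  mean_square_cvg P
    (fun (n : nat) (x : Omega) =>
       (T - t) / 2 * \sum_(1 <= j < n.+1)
         (Num.sqrt (4 * j%:R ^+ 2 - 1))^-1 *
         (zeta i1 j.-1 x * zeta i2 j x - zeta i1 j x * zeta i2 j.-1 x))
    A.
Proof.
move=> A.
have := levy_area_expansion F_filtration w_wiener t_ge0 t_lt_T i1_neq_i2 zetaE I12E I21E.
congr mean_square_cvg; apply/funext => n; apply/funext => x.
by rewrite big_add1.
Qed.
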